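(* Let $n$ be an even positive integer. Let $K \subset \mathbb{R}^n$ be a convex body with $gK=K$ for every $g\in SO(\Diamond^n)$, and let $L\subset\mathbb{R}^n$ be a centrally symmetric convex body. Then for the Lagrangian product $\Sigma := K\times L \subset (\mathbb{R}^{2n},\omega_0)$ the inequality $$c(\Sigma)^n \le n!\,\mathrm{vol}(\Sigma)$$ holds for any symplectic capacity $c$.
   Context: A convex body in $\mathbb{R}^n$ is a compact convex set with nonempty interior; it is centrally symmetric if it equals its image under $x\mapsto -x$. $\Diamond^n=\operatorname{conv}\{\pm e_1,\dots,\pm e_n\}$ is the cross-polytope and $SO(\Diamond^n):=\{g\in SO(n): g\Diamond^n=\Diamond^n\}$. $\mathbb{R}^{2n} = \mathbb{R}^n_x \times \mathbb{R}^n_y$ carries the standard symplectic form $\omega_0 = \sum_{i=1}^n dx_i\wedge dy_i$; the Lagrangian product $K\times L$ is the set of $(x,y)$ with $x\in K\subset\mathbb{R}^n_x$, $y\in L\subset\mathbb{R}^n_y$. $\mathrm{vol}$ is the symplectic volume, normalized as Lebesgue measure on $\mathbb{R}^{2n}$, so $\mathrm{vol}(B^{2n})=\pi^n/n!$, where $B^{2n}$ is the open unit ball. A symplectic capacity $c$ assigns to each $2n$-dimensional symplectic manifold $(M,\omega)$ an element of $[0,\infty]$ such that: (i) if there is a symplectic embedding of $(M,\omega)$ into $(N,\tau)$ (both of dimension $2n$), then $c(M,\omega)\le c(N,\tau)$; (ii) $c(M,\alpha\omega)=|\alpha|\,c(M,\omega)$ for all $\alpha\in\mathbb{R}\setminus\{0\}$;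 (iii) $c(B^{2n},\omega_0)=c(Z^{2n},\omega_0)=\pi$, where $Z^{2n}=B^2\times\mathbb{R}^{2n-2}$ is the symplectic cylinder, with $B^2$ the open unit disc in the $(x_1,y_1)$-plane. For a domain $\Sigma\subset\mathbb{R}^{2n}$ one writes $c(\Sigma):=c(\Sigma,\omega_0)$; for a convex body $\Sigma$, $c(\Sigma)$ means the capacity of its interior. *)

(* Defs.v *)
From HB Require Import structures.
From mathcomp Require Import all_boot all_order all_algebra.
From mathcomp Require Import all_classical all_reals all_analysis.

Set Implicit Arguments.
Unset Strict Implicit.
Unset Printing Implicit Defensive.

Import Order.TTheory GRing.Theory Num.Theory.
Import numFieldNormedType.Exports.

Local Open Scope classical_set_scope.
Local Open Scope ring_scope.

Section Smoothness.
Context {R : realType} {m : nat}.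
Implicit Types U : set 'rV[R]_m.

(* Only meant for open U: continuity and derivatives at the points of U refer
   to the ambient space. *)
Fixpoint Ck_on (k : nat) U (f : 'rV[R]_m -> R) : Prop :=
  {in U, continuous f} /\
  if k is k'.+1 then
    forall i : 'I_m, {in U, forall x, derivable f x (delta_mx 0 i)} /\
      Ck_on k' U (fun x => 'D_(delta_mx 0 i) f x)
  else True.

Definition smooth_on U (f : 'rV[R]_m -> R) := forall k, Ck_on k U f.

Definition smooth_map_on p U (g : 'rV[R]_m -> 'rV[R]_p) :=
  forall j, smooth_on U (fun x => g x 0 j).

(* A bilinear form is represented by its Gram matrix A, i.e. it maps (u, v) to
   u *m A *m v^T.  Vectors are rows and 'd g x u = u *m jacobian g x, whence the
   side on which the transpose occurs. *)
Definition pullback (g : 'rV[R]_m -> 'rV[R]_m) (A : 'rV[R]_m -> 'M[R]_m)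
    (x : 'rV[R]_m) : 'M[R]_m :=
  jacobian g x *m A (g x) *m (jacobian g x)^T.

Lemma Ck_on_cst k U (c : R) : Ck_on k U (cst c).
Proof.
have cc (d : R) : {in U, continuous (cst d : 'rV[R]_m -> R)}.
  by move=> x _; exact: cst_continuous.
elim: k c => [|k IH] c /=; split => //.
move=> i; split; first by move=> x _; exact: derivable_cst.
under eq_fun do rewrite derive_cst; exact: IH.
Qed.

Lemma Ck_onZ k U (a : R) f : a != 0 -> Ck_on k U f -> Ck_on k U (a \*: f).
Proof.
move=> a0; have ctZ (g : 'rV[R]_m -> R) :
    {in U, continuous g} -> {in U, continuous (a \*: g)}.
  move=> cg x xU; have /= h := cg x xU.
  exact: (@cvgZl_tmp _ R^o _ (nbhs x) _ a g (g x) h).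
elim: k f => [|k IH] f /= [cf df]; split => //; try exact: ctZ.
move=> i; have [dfi Ci] := df i; split.
  by move=> x xU; apply: derivableZ; exact: dfi.
suff -> : (fun x => 'D_(delta_mx 0 i) (a \*: f) x) =
    a \*: (fun x => 'D_(delta_mx 0 i) f x) by exact: IH.
apply/funext => x /=.
have [/deriveZ ->//|ndf] := pselect (derivable f x (delta_mx 0 i)).
have ndaf : ~ derivable (a \*: f) x (delta_mx 0 i).
  move=> /(@derivableZ _ _ _ _ a^-1).
  suff -> : a^-1 \*: (a \*: f) = f by [].
  by apply/funext => y /=; rewrite scalerA mulVf// scale1r.
have dv0 g : ~ derivable g x (delta_mx 0 i) -> 'D_(delta_mx 0 i) g x = 0 :> R.
  by move=> /dvgP.
by rewrite !dv0// scaler0.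
Qed.

Lemma smooth_on_coord U (j : 'I_m) : smooth_on U (fun x : 'rV[R]_m => x 0 j).
Proof.
have dc x i : 'D_(delta_mx 0 i) (fun x : 'rV[R]_m => x 0 j) x
    = (delta_mx 0 i : 'rV[R]_m) 0 j.
  pose c0 (N : 'rV[R]_m) : R := N 0 j.
  have c0_lin : linear c0 by move=> a u v; rewrite /c0 !mxE.
  pose fM := GRing.isLinear.Build _ _ _ _ _ c0_lin.
  pose f : {linear 'rV[R]_m -> R} := HB.pack c0 fM.
  have -> : (fun x : 'rV[R]_m => x 0 j) = f by [].
  rewrite deriveE; last first.
    exact/linear_differentiable/coord_continuous.
  by rewrite diff_lin//; exact: coord_continuous.
case=> [|k] /=; split => //; try by move=> x _; exact: coord_continuous.
move=> i; split.
  by move=> x _; apply: diff_derivable; exact: differentiable_coord.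
by under eq_fun do rewrite dc; exact: Ck_on_cst.
Qed.

Lemma pullback_id A x : pullback id A x = A x.
Proof.
rewrite /pullback; suff -> : jacobian id x = 1%:M :> 'M[R]_m.
  by rewrite mul1mx trmx1 mulmx1.
apply/row_matrixP => i; rewrite !rowE mul_rV_lin1 diff_val mulmx1//.
Qed.

Lemma second_countable_rV : @second_countable 'rV[R]_m.
Proof.
pose b (qk : 'rV[rat]_m * nat) : set 'rV[R]_m :=
  ball (map_mx ratr qk.1 : 'rV[R]_m) qk.2.+1%:R^-1.
exists (range b).
  by apply: (@sub_countable _ _ _ setT); [exact: card_image_le|exact: countableP].
split; first by move=> _ [qk _ <-]; exact: ball_open.
move=> x A /nbhs_ballP[e /= e0 xeA].
have [k ke] : exists k : nat, k.+1%:R^-1 < e / 2.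
  have /archi_boundP : 0 <= (e / 2)^-1 by rewrite invr_ge0 ltW// divr_gt0.
  move=> H; exists (Num.bound (e / 2)^-1).
  rewrite -[ltRHS]invrK ltf_pV2 ?posrE ?invr_gt0 ?divr_gt0//.
  by apply: (lt_trans H); rewrite ltr_nat.
have k0 : 0 < k.+1%:R^-1 :> R by rewrite invr_gt0.
have /choice[q Hq] : forall i : 'I_m, exists q : rat,
    ratr q \in `]x 0 i - k.+1%:R^-1, x 0 i + k.+1%:R^-1[.
  by move=> i; apply: rat_in_itvoo; rewrite ltrD2l gtrN.
have bx : b (\row_i q i, k) x.
  split => //= i j; rewrite ord1 !mxE -ball_normE /= ltr_distl.
  by have := Hq j; rewrite in_itv.
exists (b (\row_i q i, k)); first by split => //; exists (\row_i q i, k).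
move=> y by_; apply: xeA; rewrite (splitr e).
by apply: ball_triangle; apply: le_ball (ltW ke) _ _;
  [exact/ball_sym/bx|exact: by_].
Qed.

End Smoothness.

(* g is the expression of f in the charts phi (with domain U) and psi (with
   domain V): it extends psi \o f \o phi^-1, which is smooth on its domain. *)
Definition coord_expr (R : realType) (m : nat) (T T' : Type)
    (U : set T) (phi : T -> 'rV[R]_m) (V : set T') (psi : T' -> 'rV[R]_m)
    (f : T -> T') (g : 'rV[R]_m -> 'rV[R]_m) : Prop :=
  smooth_map_on (phi @` (U `&` f @^-1` V)) g /\
  forall p, U p -> V (f p) -> g (phi p) = psi (f p).

(* Charts are total functions, whose values outside of their domain are
   irrelevant; mfd_chart_homeo says that chart i is a homeomorphism from its
   domain onto an open subset of R^m. *)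
Record manifold (R : realType) (m : nat) := Manifold {
  mfd_space :> topologicalType;
  mfd_hausdorff : hausdorff_space mfd_space;
  mfd_second_countable : @second_countable mfd_space;
  mfd_index : Type;
  mfd_dom : mfd_index -> set mfd_space;
  mfd_chart : mfd_index -> mfd_space -> 'rV[R]_m;
  mfd_dom_open : forall i, open (mfd_dom i);
  mfd_cover : \bigcup_i mfd_dom i = setT;
  mfd_chart_inj : forall i, {in mfd_dom i &, injective (mfd_chart i)};
  mfd_chart_homeo : forall i (U : set mfd_space), U `<=` mfd_dom i ->
    (open U <-> open (mfd_chart i @` U));
  mfd_transition : forall i j, exists g,
    coord_expr (mfd_dom i) (mfd_chart i) (mfd_dom j) (mfd_chart j) id g
}.

(* sympl_form i u is the Gram matrix of the 2-form, read in chart i, at the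
   point u of the image of this chart. *)
Record symplectic_manifold (R : realType) (n : nat) := SymplecticManifold {
  sympl_mfd :> manifold R (n + n);
  sympl_form : mfd_index sympl_mfd -> 'rV[R]_(n + n) -> 'M[R]_(n + n);
  sympl_form_smooth : forall i a b,
    smooth_on (mfd_chart i @` mfd_dom i) (fun u => sympl_form i u a b);
  sympl_form_compat : forall i j, exists2 g,
    coord_expr (mfd_dom i) (mfd_chart i) (mfd_dom j) (mfd_chart j) id g &
    forall p, mfd_dom i p -> mfd_dom j p ->
      pullback g (sympl_form j) (mfd_chart i p) =
      sympl_form i (mfd_chart i p);
  sympl_form_alternating : forall i p, mfd_dom i p ->
    (sympl_form i (mfd_chart i p))^T = - sympl_form i (mfd_chart i p);
  sympl_form_nondegenerate : forall i p, mfd_dom i p ->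
    sympl_form i (mfd_chart i p) \in unitmx;
  sympl_form_closed : forall i p, mfd_dom i p -> forall a b c,
    'D_(delta_mx 0 a) (fun u => sympl_form i u b c) (mfd_chart i p) +
    'D_(delta_mx 0 b) (fun u => sympl_form i u c a) (mfd_chart i p) +
    'D_(delta_mx 0 c) (fun u => sympl_form i u a b) (mfd_chart i p) = 0
}.

(* A smooth topological embedding preserving the forms; it is automatically an
   immersion, since the form of the source is nondegenerate. *)
Record symplectic_embedding (R : realType) (n : nat)
    (M N : symplectic_manifold R n) (f : M -> N) : Prop := SymplecticEmbedding {
  embedding_inj : injective f;
  embedding_topology : forall U : set M,
    open U <-> exists2 V : set N, open V & f @^-1` V = U;
  embedding_symplectic : forall i j, exists2 g,
    coord_expr (mfd_dom i) (mfd_chart i) (mfd_dom j) (mfd_chart j) f g &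
    forall p, mfd_dom i p -> mfd_dom j (f p) ->
      pullback g (sympl_form j) (mfd_chart i p) =
      sympl_form i (mfd_chart i p)
}.

Section Rescaling.
Context {R : realType} {n : nat} (a : R) (a0 : a != 0).
Variable M : symplectic_manifold R n.

Let form (i : mfd_index M) u := a *: sympl_form i u.

Lemma rescale_form_smooth i b c :
  smooth_on (mfd_chart i @` mfd_dom i) (fun u => form i u b c).
Proof.
move=> k; have -> : (fun u => form i u b c) =
    a \*: (fun u => sympl_form i u b c) by apply/funext => u; rewrite mxE.
exact/Ck_onZ/sympl_form_smooth.
Qed.

Lemma rescale_form_compat (i j : mfd_index M) : exists2 g,
  coord_expr (mfd_dom i) (mfd_chart i) (mfd_dom j) (mfd_chart j) id g &
  forall p, mfd_dom i p -> mfd_dom j p ->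
    pullback g (form j) (mfd_chart i p) = form i (mfd_chart i p).
Proof.
have [g gij gE] := sympl_form_compat i j; exists g => // p ip jp.
by rewrite /pullback /form -scalemxAr -scalemxAl -gE.
Qed.

Lemma rescale_form_alternating (i : mfd_index M) p : mfd_dom i p ->
  (form i (mfd_chart i p))^T = - form i (mfd_chart i p).
Proof.
by move=> ip; rewrite /form linearZ/= sympl_form_alternating// scalerN.
Qed.

Lemma rescale_form_nondegenerate (i : mfd_index M) p : mfd_dom i p ->
  form i (mfd_chart i p) \in unitmx.
Proof.
by move=> ip; rewrite /form unitmxZ ?unitfE// sympl_form_nondegenerate.
Qed.

Lemma rescale_form_closed (i : mfd_index M) p : mfd_dom i p -> forall b c d,
  'D_(delta_mx 0 b) (fun u => form i u c d) (mfd_chart i p) +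
  'D_(delta_mx 0 c) (fun u => form i u d b) (mfd_chart i p) +
  'D_(delta_mx 0 d) (fun u => form i u b c) (mfd_chart i p) = 0.
Proof.
move=> ip b c d.
have DZ e x y : 'D_(delta_mx 0 e) (fun u => form i u x y) (mfd_chart i p) =
    a *: 'D_(delta_mx 0 e) (fun u => sympl_form i u x y) (mfd_chart i p).
  have -> : (fun u => form i u x y) = a \*: (fun u => sympl_form i u x y).
    by apply/funext => u; rewrite mxE.
  rewrite deriveZ//.
  have [_ /(_ e)[+ _]] := @sympl_form_smooth _ _ M i x y 1%N.
  by apply; rewrite inE; exists p.
by rewrite !DZ -!scalerDr sympl_form_closed// scaler0.
Qed.

Definition rescale : symplectic_manifold R n :=
  SymplecticManifold rescale_form_smooth rescale_form_compat
    rescale_form_alternating rescale_form_nondegenerate rescale_form_closed.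

End Rescaling.

(* A vector z of R^n x R^n has components x = lsubmx z and y = rsubmx z; this is
   the Gram matrix of the sum of the dx_i /\ dy_i. *)
Definition std_form (R : realType) (n : nat) : 'M[R]_(n + n) :=
  block_mx 0 1%:M (- 1%:M) 0.

Section Domain.
Context {R : realType} {n : nat} (U : set 'rV[R]_(n + n)) (oU : open U).

Let X : topologicalType := set_type U.
Let chart (_ : unit) (p : X) : 'rV[R]_(n + n) := val p.
Let dom (_ : unit) : set X := setT.
Let form (_ : unit) (_ : 'rV[R]_(n + n)) := std_form R n.

Lemma domain_hausdorff : hausdorff_space X.
Proof.
rewrite open_hausdorff => x y xy.
have := @norm_hausdorff _ 'rV[R]_(n + n); rewrite open_hausdorff.
move=> /(_ (val x) (val y)); rewrite val_eqE => /(_ xy)[[A B] [/= Ax By]].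
move=> [oA oB /eqP AB]; exists (val @^-1` A, val @^-1` B) => /=.
  by move: Ax By; rewrite !inE.
split; [by exists A|by exists B|].
by apply/eqP; rewrite -preimage_setI AB preimage_set0.
Qed.

Lemma domain_second_countable : @second_countable X.
Proof.
have [B cB [oB bB]] := @second_countable_rV R (n + n).
exists [set (val : X -> _) @^-1` V | V in B].
  by apply: sub_countable cB; exact: card_image_le.
split; first by move=> _ [V BV <-]; exists V => //; exact: oB.
move=> x A [_ [[V oV <-] Vx VA]].
have /bB[W [BW Wx] WV] : nbhs (val x) V by exact: open_nbhs_nbhs.
exists (val @^-1` W); first by split => //; exists W.
by move=> y Wy; apply: VA; exact: WV.
Qed.

Lemma domain_dom_open i : open (dom i). Proof. exact: openT. Qed.

Lemma domain_cover : \bigcup_i dom i = setT.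
Proof. by apply/seteqP; split => // x _; exists tt. Qed.

Lemma domain_chart_inj i : {in dom i &, injective (chart i)}.
Proof. by move=> x y _ _; exact: val_inj. Qed.

Lemma domain_chart_homeo i (V : set X) : V `<=` dom i ->
  (open V <-> open (chart i @` V)).
Proof.
move=> _; split => [[W oW <-]|oV].
  suff -> : chart i @` (val @^-1` W) = U `&` W by exact: openI.
  apply/seteqP; split => [_ [x Wx <-]|x [Ux Wx]].
    by split => //; exact: set_valP.
  by exists (exist _ x (mem_set Ux)).
exists (chart i @` V) => //; apply/seteqP; split => [x [y Vy /val_inj <-]//|x].
by move=> Vx; exists x.
Qed.

Lemma domain_transition i j : coord_expr (dom i) (chart i) (dom j) (chart j) id id.
Proof. by split => // k; exact: smooth_on_coord. Qed.

Definition domain_mfd : manifold R (n + n) :=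
  Manifold domain_hausdorff domain_second_countable domain_dom_open
    domain_cover domain_chart_inj domain_chart_homeo
    (fun i j => ex_intro _ id (domain_transition i j)).

Lemma domain_form_smooth (i : mfd_index domain_mfd) a b :
  smooth_on (mfd_chart i @` mfd_dom i) (fun u => form i u a b).
Proof. by move=> k; exact: Ck_on_cst. Qed.

Lemma domain_form_compat (i j : mfd_index domain_mfd) : exists2 g,
  coord_expr (mfd_dom i) (mfd_chart i) (mfd_dom j) (mfd_chart j) id g &
  forall p, mfd_dom i p -> mfd_dom j p ->
    pullback g (form j) (mfd_chart i p) = form i (mfd_chart i p).
Proof. by exists id => [|p _ _]; [exact: domain_transition|rewrite pullback_id]. Qed.

Lemma domain_form_alternating (i : mfd_index domain_mfd) p : mfd_dom i p ->
  (form i (mfd_chart i p))^T = - form i (mfd_chart i p).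
Proof.
by move=> _; rewrite /form /std_form tr_block_mx opp_block_mx !trmx0 linearN/=
  trmx1 !oppr0 opprK.
Qed.

Lemma domain_form_nondegenerate (i : mfd_index domain_mfd) p : mfd_dom i p ->
  form i (mfd_chart i p) \in unitmx.
Proof.
move=> ip; have := domain_form_alternating ip; rewrite /form => sT.
suff /mulmx1_unit[] : std_form R n *m (std_form R n)^T = 1%:M by [].
rewrite sT /std_form opp_block_mx mulmx_block !oppr0 opprK.
by rewrite !mul0mx !mulmx0 !mulmx1 !mulNmx !mulmxN !mul1mx !opprK !addr0 !add0r -scalar_mx_block.
Qed.

Lemma domain_form_closed (i : mfd_index domain_mfd) p : mfd_dom i p ->
  forall a b c,
  'D_(delta_mx 0 a) (fun u => form i u b c) (mfd_chart i p) +
  'D_(delta_mx 0 b) (fun u => form i u c a) (mfd_chart i p) +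
  'D_(delta_mx 0 c) (fun u => form i u a b) (mfd_chart i p) = 0.
Proof. by move=> _ a b c; rewrite !derive_cst !addr0. Qed.

Definition domain : symplectic_manifold R n :=
  SymplecticManifold domain_form_smooth domain_form_compat
    domain_form_alternating domain_form_nondegenerate domain_form_closed.

End Domain.

Section Capacity.
Context {R : realType} {n : nat}.

Definition unit_ball : set 'rV[R]_(n + n) := [set z | \sum_i z 0 i ^+ 2 < 1].

Definition cylinder (n_gt0 : (0 < n)%N) : set 'rV[R]_(n + n) :=
  let i := Ordinal n_gt0 in
  [set z | lsubmx z 0 i ^+ 2 + rsubmx z 0 i ^+ 2 < 1].

Lemma open_unit_ball : open unit_ball.
Proof.
rewrite (_ : unit_ball =
  (fun z : 'rV[R]_(n + n) => \sum_i z 0 i ^+ 2) @^-1` [set x | x < 1])//.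
apply: open_comp; last exact: open_lt.
have cF : continuous (fun z : 'rV[R]_(n + n) => \sum_i z 0 i ^+ 2 : R^o).
  apply: continuous_big => [|i _ z]; first exact: add_continuous.
  by apply: (@continuous_comp _ _ _ (fun z : 'rV[R]_(n + n) => z 0 i)
    (fun x => x ^+ 2)); [exact: coord_continuous|exact: exprn_continuous].
by move=> z _; exact: cF.
Qed.

Lemma open_cylinder (n_gt0 : (0 < n)%N) : open (cylinder n_gt0).
Proof.
set i := Ordinal n_gt0.
rewrite (_ : cylinder _ = (fun z : 'rV[R]_(n + n) =>
  z 0 (lshift n i) ^+ 2 + z 0 (rshift n i) ^+ 2) @^-1` [set x | x < 1]); last first.
  by apply/seteqP; split => z; rewrite /cylinder/= !mxE.
apply: open_comp; last exact: open_lt.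
have csqr k : continuous (fun z : 'rV[R]_(n + n) => z 0 k ^+ 2 : R^o).
  by move=> z; apply: (@continuous_comp _ _ _ (fun z : 'rV[R]_(n + n) => z 0 k)
    (fun x => x ^+ 2)); [exact: coord_continuous|exact: exprn_continuous].
move=> z _; exact: (@continuousD R R^o _ _ _ z (csqr (lshift n i) z)
  (csqr (rshift n i) z)).
Qed.

Record symplectic_capacity (n_gt0 : (0 < n)%N)
    (c : symplectic_manifold R n -> \bar R) : Prop := SymplecticCapacity {
  capacity_ge0 : forall M, (0 <= c M)%E;
  capacity_monotone : forall M N : symplectic_manifold R n,
    (exists f : M -> N, symplectic_embedding f) -> (c M <= c N)%E;
  capacity_conformal : forall M (a : R) (a0 : a != 0),
    c (rescale a0 M) = (`|a|%:E * c M)%E;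
  capacity_ball : c (domain open_unit_ball) = pi%:E;
  capacity_cylinder : c (domain (@open_cylinder n_gt0)) = pi%:E
}.

Definition capacity_body (c : symplectic_manifold R n -> \bar R)
    (S : set 'rV[R]_(n + n)) : \bar R :=
  c (domain (open_interior S)).

End Capacity.

Section Convexity.
Context {R : realType} {n : nat}.
Implicit Types A K L : set 'rV[R]_n.

Definition convex_body K :=
  [/\ compact K, convex_set (K : set (convex_lmodType 'rV[R]_n)) & K° !=set0].

Definition centrally_symmetric K := [set - x | x in K] = K.

Definition convex_hull A : set 'rV[R]_n :=
  smallest (fun C => convex_set (C : set (convex_lmodType 'rV[R]_n))) A.

Definition cross_polytope : set 'rV[R]_n :=
  convex_hull [set x | exists i, x = delta_mx 0 i \/ x = - delta_mx 0 i].

(* The usual action x |-> g x, for row vectors. *)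
Definition mx_image (g : 'M[R]_n) A : set 'rV[R]_n := [set x *m g^T | x in A].

Definition special_orthogonal : set 'M[R]_n :=
  [set g | g *m g^T = 1%:M /\ \det g = 1].

Definition SO_cross_polytope : set 'M[R]_n :=
  [set g | special_orthogonal g /\ mx_image g cross_polytope = cross_polytope].

Definition lagrangian_product K L : set 'rV[R]_(n + n) :=
  [set z | K (lsubmx z) /\ L (rsubmx z)].

End Convexity.

Section Volume.
Context {R : realType} {m : nat}.
Implicit Types a b : 'rV[R]_m.

Definition box a b : set 'rV[R]_m := [set x | forall i, a 0 i <= x 0 i <= b 0 i].

Definition box_volume a b : R := \prod_i Num.max 0 (b 0 i - a 0 i).

(* Lebesgue outer measure, i.e. Lebesgue measure on measurable sets. *)
Definition volume (A : set 'rV[R]_m) : \bar R :=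
  ereal_inf [set (\sum_(0 <= k <oo) (box_volume (F k).1 (F k).2)%:E)%E |
    F in [set F : nat -> 'rV[R]_m * 'rV[R]_m |
      A `<=` \bigcup_k box (F k).1 (F k).2]].

End Volume.

(* Main.v *)
From HB Require Import structures.
Require Import Defs.
From mathcomp Require Import all_boot all_order all_algebra.
From mathcomp Require Import fingroup perm.
From mathcomp Require Import all_classical all_reals all_analysis.
From mathcomp Require Import ring lra zify.

Set Implicit Arguments.
Unset Strict Implicit.
Unset Printing Implicit Defensive.

Import Order.TTheory GRing.Theory Num.Theory.
Import numFieldNormedType.Exports.

Local Open Scope classical_set_scope.
Local Open Scope ring_scope.

(** Let KP be the polar body of K, that is the set of the u with <x, u> <= 1 on K.
    Since n is even, - 1 is a rotation that preserves the cross-polytope, so K is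
    centrally symmetric.  The inequality follows from two facts.

    Symplectic part: (c/4) KP is contained in L, where c is the capacity of K x L.
    If |<x, u>| < al on K and |<y, v>| < be on L, a linear symplectic map takes
    (<x, u>, <y, v>) to a pair of conjugate coordinates, so that K x L lies above
    an open rectangle of area 4 al be / <u, v>.  Up to scaling, the action-angle
    coordinates (p, q) |-> sqrt p (cos 2 pi q, sin 2 pi q) preserve areas and embed
    an open rectangle into a disc; hence c <= 4 al be / <u, v>
    ([capacity_lagrangian_product_le]).  If a point (c/4) u with u in KP were
    outside of L, a hyperplane separating it from L would contradict this bound
    ([dilate_polar_sub]).

    Convex part: |K| |KP| >= 4^n / n!, the symmetric Mahler inequality for this
    symmetry class.  Let n > 2 and let 1_k be the sum of the first k basis
    vectors.  The subgroup fixing 1_k fixes no other direction, so averaging over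
    it replaces a maximizer of <., 1_k> on K by a multiple s_k 1_k; then
    1_k / (k s_k) belongs to KP ([exists_polar_corners]).  All the signed
    permutations of these vectors are in the same bodies.  A convex set containing
    the signed permutations of all the s_k 1_k contains, in each of the 2^n n! Weyl
    chambers, the simplex spanned by 0 and the s_k 1_k, of volume
    (\prod_k s_k) / n!.  Thus |K| >= 2^n \prod_k s_k and
    |KP| >= 2^n \prod_k 1 / (k s_k), whose product is 4^n / n!.
    For n = 2 the stabilizer of (1, 1) is trivial; instead one uses two dual pairs,
    (f, 0) in K with u in KP such that u_1 = 1 / f, and a maximizer x of x_1 + x_2
    on K, with maximum rho and (1, 1) / rho in KP.  The quarter turns of (f, 0) and
    x span 8 triangles of total area 2 f rho in K, those of (1, 1) / rho and u span
    8 triangles of total area 4 / (f rho) in KP ([volume_product_dim2]).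

    Volumes are bounded below by counting lattice points: the number of points of
    eps Z^m in a compact set, times eps^m, is asymptotically at most its outer
    Lebesgue measure, because finitely many slightly enlarged boxes of any
    countable cover suffice ([volume_ge_lattice]).  Lattice points of K x L are
    pairs of lattice points, and every simplex above has a lattice basis adapted
    to it, in which its points are counted by an elementary induction
    ([card_simplex_points_ge]). *)

(** * Smooth functions of several variables *)

Section SmoothCalculus.
Context {R : realType} {m : nat} (U : set 'rV[R]_m) (oU : open U).
Implicit Types f g : 'rV[R]_m -> R.

Lemma near_open (P : 'rV[R]_m -> Prop) x :
  U x -> (forall y, U y -> P y) -> \forall y \near x, P y.
Proof.
by move=> Ux UP; near do apply: UP; exact: open_nbhs_nbhs.
Unshelve. all: by end_near. Qed.

(** Openness of [U] matters: derivatives at a point of [U] see a neighbourhood.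
    *)
Lemma Ck_on_ext k f g :
  (forall x, U x -> f x = g x) -> Ck_on k U f -> Ck_on k U g.
Proof.
have cext f' g' : (forall x, U x -> f' x = g' x) ->
    {in U, continuous f'} -> {in U, continuous g'}.
  move=> fg cf x xU; have Ux := set_mem xU.
  have fgx : \forall y \near x, f' y = g' y by exact: near_open.
  rewrite /continuous_at -(fg _ Ux); apply: cvg_trans (cf x xU).
  exact: (@near_eq_cvg _ _ (nbhs x) _ f' g' fgx).
elim: k f g => [|k IH] f g fg /= [cf df]; first by split=> //;
  exact: cext fg cf.
split; first exact: cext fg cf.
move=> i; have [dfi Cfi] := df i; split.
  move=> x xU; have Ux := set_mem xU.
  apply: near_eq_derivable (dfi x xU).
  exact: near_open.
apply: IH Cfi => x Ux; apply: near_eq_derive.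
exact: near_open.
Qed.

Lemma Ck_onS k f : Ck_on k.+1 U f -> Ck_on k U f.
Proof.
elim: k f => [|k IH] f [cf df]; split=> // i.
by have [dfi Cfi] := df i; split=> //; exact: IH.
Qed.

Lemma Ck_onD k f g :
  Ck_on k U f -> Ck_on k U g -> Ck_on k U (fun x => f x + g x).
Proof.
elim: k f g => [|k IH] f g /= [cf df] [cg dg].
  by split=> // x xU; apply: (@continuousD R R^o); [exact: cf|exact: cg].
split; first by move=> x xU; apply: (@continuousD R R^o); [exact: cf|exact: cg].
move=> i; have [dfi Cfi] := df i; have [dgi Cgi] := dg i; split.
  by move=> x xU; apply: derivableD; [exact: dfi|exact: dgi].
apply: Ck_on_ext (IH _ _ Cfi Cgi) => x Ux; rewrite deriveD//.
  by apply: dfi; rewrite inE.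
by apply: dgi; rewrite inE.
Qed.

Lemma Ck_onM k f g :
  Ck_on k U f -> Ck_on k U g -> Ck_on k U (fun x => f x * g x).
Proof.
elim: k f g => [|k IH] f g; move=> Hf Hg.
  have [[cf _] [cg _]] := (Hf, Hg).
  by split=> // x xU; apply: continuousM; [exact: cf|exact: cg].
have [/= [cf df] [cg dg]] := (Hf, Hg).
split; first by move=> x xU; apply: continuousM; [exact: cf|exact: cg].
move=> i; have [dfi Cfi] := df i; have [dgi Cgi] := dg i; split.
  by move=> x xU; apply: derivableM; [exact: dfi|exact: dgi].
apply: Ck_on_ext (Ck_onD (IH _ _ (Ck_onS Hf) Cgi) (IH _ _ (Ck_onS Hg) Cfi)) =>
  x Ux.
rewrite deriveM//; first by apply: dfi; rewrite inE.
by apply: dgi; rewrite inE.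
Qed.

Lemma differentiable_comp_coord (phi : R -> R) (x : 'rV[R]_m) j d :
  is_derive (x 0 j) 1 phi d ->
  differentiable (fun y : 'rV[R]_m => phi (y 0 j)) x.
Proof.
move=> [dphi _]; apply: (@differentiable_comp _ _ _ _ (fun y : 'rV[R]_m =>
  y 0 j) phi).
  exact: differentiable_coord.
exact/derivable1_diffP.
Qed.

Lemma derive_coord (x v : 'rV[R]_m) j :
  'D_v (fun y : 'rV[R]_m => y 0 j) x = v 0 j.
Proof.
pose c0 (N : 'rV[R]_m) : R := N 0 j.
have c0_lin : linear c0 by move=> a u w; rewrite /c0 !mxE.
pose fM := GRing.isLinear.Build _ _ _ _ _ c0_lin.
pose f : {linear 'rV[R]_m -> R} := HB.pack c0 fM.
have -> : (fun y : 'rV[R]_m => y 0 j) = f by [].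
rewrite deriveE; last exact/linear_differentiable/coord_continuous.
by rewrite diff_lin//; exact: coord_continuous.
Qed.

Lemma derive_comp_coord (phi : R -> R) (x v : 'rV[R]_m) j d :
  is_derive (x 0 j) 1 phi d ->
  'D_v (fun y : 'rV[R]_m => phi (y 0 j)) x = v 0 j * d.
Proof.
move=> dphi; rewrite deriveE; last exact: differentiable_comp_coord dphi.
case: dphi => dphi Dphi; have dphi' := (derivable1_diffP _ _).1 dphi.
rewrite (@diff_comp _ _ _ _ (fun y : 'rV[R]_m => y 0 j) phi)//=; last first.
  exact: differentiable_coord.
rewrite -[X in 'd phi _ X]mulr1 -[_ * 1]/(_ *: (1 : R^o)) linearZ/=.
rewrite -(deriveE _ dphi') Dphi -deriveE; last exact: differentiable_coord.
by rewrite derive_coord.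
Qed.

(** Carrying all the derivatives [phi i] along at once makes the induction on
    the order of smoothness close. *)
Lemma Ck_on_comp_coord (phi : nat -> R -> R) j k l :
  (forall x i, U x -> is_derive (x 0 j) 1 (phi i) (phi i.+1 (x 0 j))) ->
  Ck_on k U (fun x => phi l (x 0 j)).
Proof.
move=> dphi; elim: k l => [|k IH] l.
  split=> // x /set_mem Ux; apply: differentiable_continuous.
  exact: differentiable_comp_coord (dphi _ _ Ux).
split; first move=> x /set_mem Ux.
  apply: differentiable_continuous.
  exact: differentiable_comp_coord (dphi _ _ Ux).
move=> i; split; first move=> x /set_mem Ux.
  apply: diff_derivable.
  exact: differentiable_comp_coord (dphi _ _ Ux).
apply: (@Ck_on_ext _ (fun x => (delta_mx 0 i : 'rV[R]_m) 0 j * phi l.+1 (x 0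
  j))).
  by move=> x Ux; rewrite (derive_comp_coord _ (dphi _ _ Ux)).
apply: Ck_onM; last exact: IH.
exact: Ck_on_cst.
Qed.

End SmoothCalculus.

Lemma continuous_rV {R : realType} {T : topologicalType} {p : nat}
    (f : T -> 'rV[R]_p) x :
  (forall j, {for x, continuous (fun y => f y 0 j)}) -> {for x, continuous f}.
Proof.
move=> cf; apply/(@cvgrPdist_lt _ _ _ (nbhs x) (nbhs_filter x)) => e e0.
have : \forall y \near nbhs x, forall j, `|f x 0 j - f y 0 j| < e.
  apply: (@filter_forall _ _ (fun j =>
    [set y | `|f x 0 j - f y 0 j| < e]) (nbhs x) (nbhs_filter x)) => j.
  by have /(@cvgrPdist_lt _ _ _ (nbhs x) (nbhs_filter x)) := cf j; exact.
apply: (@filterS _ (nbhs x) (nbhs_filter x)) => y fy;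
  rewrite /Num.Def.normr/= mx_normrE.
by apply: bigmax_lt => //= -[i j] _; rewrite !mxE/= ord1; exact: fy.
Qed.

Lemma Ck_on_sum (R : realType) m (U : set 'rV[R]_m) (oU : open U) k
    (I : Type) (r : seq I) (F : I -> 'rV[R]_m -> R) :
  (forall i, Ck_on k U (F i)) -> Ck_on k U (fun x => \sum_(i <- r) F i x).
Proof.
move=> CF; elim: r => [|i r IH].
  by under eq_fun do rewrite big_nil; exact: Ck_on_cst.
by under eq_fun do rewrite big_cons; exact: Ck_onD.
Qed.

Lemma differentiable_rV (R : realType) m p (f : 'rV[R]_m -> 'rV[R]_p) x :
  (forall j, differentiable (fun y => f y 0 j) x) -> differentiable f x.
Proof.
move=> df.
have -> : f = \sum_(j < p) (fun y => f y 0 j *: (delta_mx 0 j : 'rV[R]_p)).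
  by apply/funext => y; rewrite fct_sumE [LHS]row_sum_delta.
apply: differentiable_sum => j; exact: differentiableZl.
Qed.

(** Differentiability is assumed since partial derivatives alone do not
    determine the differential. *)
Lemma jacobianE (R : realType) m p (f : 'rV[R]_m -> 'rV[R]_p) x i j :
  (forall j, differentiable (fun y => f y 0 j) x) ->
  jacobian f x i j = 'D_(delta_mx 0 i) (fun y => f y 0 j) x.
Proof.
move=> /differentiable_rV df; have := deriveEjacobian (delta_mx 0 i) df.
rewrite -rowE derive_mx; last exact: diff_derivable.
by move=> /rowP/(_ j); rewrite !mxE.
Qed.

(** * Symplectic embeddings between domains *)

Section DomainEmbedding.
Context {R : realType} {n : nat} (U V : set 'rV[R]_(n + n)).
Variables (oU : open U) (oV : open V).
Variables (f h : 'rV[R]_(n + n) -> 'rV[R]_(n + n)) (a : R) (a0 : a != 0).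
Hypothesis f_smooth : smooth_map_on U f.
Hypothesis f_maps : forall x, U x -> V (f x).
Hypothesis f_linv : forall x, U x -> h (f x) = x.
Hypothesis h_cont : forall x, U x -> {for f x, continuous h}.
Hypothesis f_sympl : forall x, U x ->
  pullback f (fun=> a *: std_form R n) x = std_form R n.

Let phi (x : set_type U) : set_type V :=
  exist _ (f (val x)) (mem_set (f_maps (set_valP x))).

(** A smooth map pulling [a *: std_form] back to [std_form] is a symplectic
    embedding as soon as it has a left inverse that is continuous at the points
    of the image: this gives both injectivity and the topological embedding. *)
Lemma domain_embedding : exists g : domain oU -> rescale a0 (domain oV),
  symplectic_embedding g.
Proof.
exists phi; split.
- move=> x y /(congr1 val)/= fxy; apply/val_inj.
  by rewrite -(f_linv (set_valP x)) -(f_linv (set_valP y)) fxy.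
- move=> O; split=> [[W oW WO]|[_ [W oW <-] <-]].
    exists (val @^-1` ((h @^-1` W)°)); first by exists ((h @^-1` W)°) => //;
      exact: open_interior.
    rewrite -WO; apply/seteqP; split=> x /=.
      by move/interior_subset => /=; rewrite f_linv//; exact: set_valP.
    move=> Wx; apply: h_cont; first exact: set_valP.
    by rewrite f_linv; [exact: open_nbhs_nbhs|exact: set_valP].
  exists ((f @^-1` W)° `&` U); first by apply: openI => //;
    exact: open_interior.
  apply/seteqP; split=> x /=; first by case=> /interior_subset.
  move=> Wx; have Ux := set_valP x; split=> //.
  suff cf : {for val x, continuous f} by apply: cf; exact: open_nbhs_nbhs.
  have cfj j : {for val x, continuous (fun y => f y 0 j)}.
    by have [cf _] := f_smooth j 0%N; apply: cf; exact: mem_set.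
  exact: continuous_rV.
- move=> i j; exists f; last by move=> p _ _; exact: f_sympl (set_valP p).
  split=> //.
  suff -> : mfd_chart i @` (@mfd_dom _ _ (domain_mfd oU) i `&` phi @^-1`
    @mfd_dom _ _ (domain_mfd oV) j) = U.
    exact: f_smooth.
  apply/seteqP; split=> [_ [x _ <-]|x Ux]; first exact: set_valP.
  by exists (exist _ x (mem_set Ux)).
Qed.

End DomainEmbedding.

(** * Linear maps and derivatives of the polar coordinates *)

Lemma std_form_entry (R : realType) n (J : 'M[R]_(n + n)) a b :
  (J *m std_form R n *m J^T) a b =
  \sum_(l < n) (J a (lshift n l) * J b (rshift n l) -
                J a (rshift n l) * J b (lshift n l)).
Proof.
rewrite /std_form -[J in LHS]hsubmxK tr_row_mx mul_row_block mul_row_col !mulmx0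
  add0r addr0.
rewrite mulmxN !mulmx1 mulNmx addrC !mxE -sumrB; apply: eq_bigr => l _.
by rewrite !mxE.
Qed.

Section Linear.
Context {R : realType} {m : nat} (A : 'M[R]_m).

Lemma smooth_mulmxr (U : set 'rV[R]_m) (oU : open U) :
  smooth_map_on U (fun x : 'rV[R]_m => x *m A).
Proof.
move=> j k; have -> : (fun x : 'rV[R]_m => (x *m A) 0 j) =
    (fun x => \sum_i x 0 i * A i j) by apply/funext => x; rewrite mxE.
apply: Ck_on_sum => // i; apply: Ck_onM => //; last exact: Ck_on_cst.
exact: smooth_on_coord.
Qed.

Lemma continuous_mulmxr : continuous (fun x : 'rV[R]_m => x *m A).
Proof.
move=> x; apply: continuous_rV => j.
by have [cf _] := smooth_mulmxr openT j 0%N; apply: cf; exact: mem_set.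
Qed.

Lemma jacobian_mulmxr (x : 'rV[R]_m) :
  jacobian (fun x : 'rV[R]_m => x *m A) x = A.
Proof.
rewrite /jacobian; have -> : (fun x : 'rV[R]_m => x *m A) = mulmxr A by [].
rewrite diff_lin; last exact: continuous_mulmxr.
by apply/row_matrixP => i; rewrite !rowE mul_rV_lin1.
Qed.

End Linear.

Section PolarDerivatives.
Context {R : realType}.
Implicit Types p q c : R.

(** A phase of [pi / 2] per derivative keeps all derivatives in one family,
    which contains sine too, for [c = - pi / 2]. *)
Lemma is_derive_cos_iter (c q : R) k :
  is_derive q 1 (fun q => pi ^+ k * cos (pi * q + c + k%:R * (pi / 2)))
    (pi ^+ k.+1 * cos (pi * q + c + k.+1%:R * (pi / 2))).
Proof.
apply: is_derive_eq.
have -> : pi * q + c + k.+1%:R * (pi / 2) = pi * q + c + k%:R * (pi / 2) + pi /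
  2 :> R.
  by rewrite -natr1; ring.
rewrite cosDpihalf !addr0 exprSr -mulrA; congr (_ * _).
by rewrite mulrC [_%:A]mulr1.
Qed.

Lemma is_derive_sqrt_affine p : -1 < p ->
  is_derive p 1 (fun p => Num.sqrt ((1 + p) / 2)) (Num.sqrt ((1 + p) / 2) / (2 *
    (1 + p))).
Proof.
move=> p1; have s0 : 0 < (1 + p) / 2 by lra.
have p0 : 0 < 1 + p by lra.
have := @is_derive1_sqrt _ _ s0 => Ds.
have Da : is_derive p 1 (fun p : R => (1 + p) / 2) 2^-1.
  by apply: is_derive_eq; rewrite /GRing.scale/=; field.
suff -> : Num.sqrt ((1 + p) / 2) / (2 * (1 + p)) = (2 * Num.sqrt ((1 + p) /
  2))^-1 * 2^-1.
  exact: is_derive1_comp.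
set r := Num.sqrt _; have r0 : r != 0 by rewrite gt_eqF// sqrtr_gt0.
have rr : r ^+ 2 = (1 + p) / 2 by rewrite sqr_sqrtr// ltW.
have -> : 1 + p = 2 * r ^+ 2 by rewrite rr; field.
by field; rewrite r0.
Qed.

(** Up to constants, the [k]-th derivative of [sqrt ((1 + p) / 2)] is this root
    divided by the [k]-th power of [1 + p]. *)
Lemma is_derive_sqrt_iter (c p : R) k : -1 < p ->
  is_derive p 1 (fun p => c * (Num.sqrt ((1 + p) / 2) * ((1 + p)^-1) ^+ k))
    (c * (2^-1 - k%:R) * (Num.sqrt ((1 + p) / 2) * ((1 + p)^-1) ^+ k.+1)).
Proof.
move=> p1; have Ds := is_derive_sqrt_affine p1.
have p0 : 1 + p != 0 by lra.
have D1 : is_derive p 1 (fun p : R => 1 + p) 1.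
  by apply: is_derive_eq; rewrite add0r mulr1.
have Dv : is_derive p 1 (fun p : R =>
  (1 + p)^-1) (- (1 + p) ^- 2 *: 1) by apply: is_deriveV.
have Dk : is_derive p 1 (fun p : R =>
  (1 + p)^-1 ^+ k) (- k%:R * (1 + p)^-1 ^+ k.+1).
  rewrite (_ : (fun _ => _) = (fun p : R => (1 + p)^-1) ^+ k);
    last by rewrite exprfctE.
  apply: is_derive_eq; rewrite /GRing.scale/= mulr1.
  case: k => [|k]; first by rewrite oppr0 !mul0r.
  by rewrite /= -exprVn !exprS expr0; ring.
have DM : is_derive p 1 (fun p => Num.sqrt ((1 + p) / 2) * (1 + p)^-1 ^+ k)
   ((2^-1 - k%:R) * (Num.sqrt ((1 + p) / 2) * (1 + p)^-1 ^+ k.+1)).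
  apply: is_derive_eq; rewrite /GRing.scale/= exprS; move: (_ ^+ k) => e.
  by field.
apply: is_derive_eq.
by rewrite /GRing.scale/= mulrA.
Qed.

End PolarDerivatives.

(** * Polar coordinates as a map from a strip to the cylinder *)

Section PolarMap.
Context {R : realType} {n : nat} (n_gt0 : (0 < n)%N).
Implicit Types z w : 'rV[R]_(n + n).

Let x0 : 'I_(n + n) := lshift n (Ordinal n_gt0).
Let y0 : 'I_(n + n) := rshift n (Ordinal n_gt0).

Definition strip : set 'rV[R]_(n + n) :=
  [set z | -1 < z 0 x0 < 1 /\ -1 < z 0 y0 < 1].

(** In the first pair of coordinates [polar] has Jacobian determinant [pi / 4].
    Scaling the remaining positions by the same factor makes the whole map
    conformal. *)
Definition polar_scale (k : 'I_(n + n)) : R := if (k < n)%N then pi / 4 else 1.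

(** Action-angle coordinates: the action is [(1 + p) / 2], the angle [pi q], for
    the first pair [(p, q)] of conjugate coordinates. *)
Definition polar z : 'rV[R]_(n + n) := \row_k
  if k == x0 then Num.sqrt ((1 + z 0 x0) / 2) * cos (pi * z 0 y0)
  else if k == y0 then Num.sqrt ((1 + z 0 x0) / 2) * sin (pi * z 0 y0)
  else polar_scale k * z 0 k.

(** The angle is recovered by the half-angle formula [tan (t / 2) = sin t / (1 +
    cos t)], which is continuous off the negative axis. *)
Definition polar_inv w : 'rV[R]_(n + n) := \row_k
  if k == x0 then 2 * (w 0 x0 ^+ 2 + w 0 y0 ^+ 2) - 1
  else if k == y0 then 2 / pi *
    atan (w 0 y0 / (Num.sqrt (w 0 x0 ^+ 2 + w 0 y0 ^+ 2) + w 0 x0))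
  else (polar_scale k)^-1 * w 0 k.

Let y0x0 : y0 != x0.
Proof. by rewrite /y0 /x0 eq_sym eq_lrshift. Qed.

Lemma polar_scale_neq0 k : polar_scale k != 0.
Proof. by rewrite /polar_scale; case: ifP => _;
  rewrite ?oner_eq0// gt_eqF// divr_gt0// pi_gt0. Qed.

Lemma open_strip : open strip.
Proof.
have co k : open [set z : 'rV[R]_(n + n) | -1 < z 0 k < 1].
  rewrite (_ : [set _ | _] = (fun z => z 0 k) @^-1` `]-1, 1[%classic);
    last first.
    by apply/seteqP; split=> z /=; rewrite in_itv.
  apply: open_comp; last exact: itv_open.
  by move=> z _; exact: coord_continuous.
by rewrite (_ : strip = [set z | -1 < z 0 x0 < 1] `&` [set z | -1 < z 0 y0 <
  1])//; apply: openI; exact: co.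
Qed.

Lemma polar_smooth : smooth_map_on strip polar.
Proof.
move=> j k.
have Csqrt : Ck_on k strip (fun z => Num.sqrt ((1 + z 0 x0) / 2)).
  pose c (i : nat) : R := \prod_(l < i) (2^-1 - l%:R).
  pose phi i (p : R) := c i * (Num.sqrt ((1 + p) / 2) * (1 + p)^-1 ^+ i).
  rewrite (_ : (fun _ => _) = (fun z => phi 0%N (z 0 x0))); last first.
    by apply/funext => z; rewrite /phi /c big_ord0 expr0 mul1r mulr1.
  apply: Ck_on_comp_coord => [|z i [/andP[z1 _] _]]; first exact: open_strip.
  by rewrite /phi /c big_ord_recr /=; exact: is_derive_sqrt_iter.
have Ccos c : Ck_on k strip (fun z => cos (pi * z 0 y0 + c)).
  pose phi i (q : R) := pi ^+ i * cos (pi * q + c + i%:R * (pi / 2)).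
  rewrite (_ : (fun _ => _) = (fun z => phi 0%N (z 0 y0))); last first.
    by apply/funext => z; rewrite /phi expr0 mul1r mul0r addr0.
  apply: Ck_on_comp_coord => [|z i _]; first exact: open_strip.
  exact: is_derive_cos_iter.
rewrite /polar; under eq_fun do rewrite mxE.
have [_|_] := eqVneq j x0.
  apply: Ck_onM => //; first exact: open_strip.
  by under eq_fun do rewrite -[_ * _]addr0; exact: Ccos.
have [_|_] := eqVneq j y0.
  apply: Ck_onM => //; first exact: open_strip.
  by under eq_fun do rewrite -cosBpihalf; exact: Ccos.
apply: Ck_onM; [exact: open_strip|exact: Ck_on_cst|exact: smooth_on_coord].
Qed.

Lemma polar_radius z : strip z ->
  polar z 0 x0 ^+ 2 + polar z 0 y0 ^+ 2 = (1 + z 0 x0) / 2.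
Proof.
move=> [/andP[z1 _] _]; rewrite !mxE eqxx (negbTE y0x0) eqxx !exprMn -mulrDr.
by rewrite cos2Dsin2 mulr1 sqr_sqrtr//; lra.
Qed.

Lemma polar_cylinder z : strip z -> cylinder n_gt0 (polar z).
Proof.
move=> sz; rewrite /cylinder /= !mxE -/x0 -/y0.
have := polar_radius sz; rewrite !mxE eqxx (negbTE y0x0) eqxx => ->.
by case: sz => /andP[_ ?] _; lra.
Qed.

(** Angles in the open interval from [- pi] to [pi] avoid the negative
    half-axis, where the half-angle formula breaks down. *)
Lemma polar_slit z : strip z ->
  0 < Num.sqrt (polar z 0 x0 ^+ 2 + polar z 0 y0 ^+ 2) + polar z 0 x0.
Proof.
move=> sz; rewrite polar_radius// !mxE eqxx.
case: sz => /andP[z1 _] /andP[y1 y2].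
rewrite -[X in X + _]mulr1 -mulrDr mulr_gt0//; first by rewrite sqrtr_gt0; lra.
have cN : -1 < cos (pi * `|z 0 y0|).
  rewrite -cospi ltr_cos// ?in_itv/= ?pi_ge0 ?lexx ?mulr_ge0 ?pi_ge0//=.
    by rewrite gtr_pMr ?pi_gt0// ltr_norml y1.
  by rewrite ger_pMr ?pi_gt0// ler_norml !ltW.
suff -> : cos (pi * z 0 y0) = cos (pi * `|z 0 y0|) by rewrite -(subrr 1) ltrD2l.
case: (leP 0 (z 0 y0)) => h; first by rewrite ger0_norm.
by rewrite ltr0_norm// mulrN cosN.
Qed.

Lemma polarK z : strip z -> polar_inv (polar z) = z.
Proof.
move=> sz; apply/rowP => k; rewrite mxE.
have [->|kx] := eqVneq k x0.
  by rewrite polar_radius//; lra.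
have [->|ky] := eqVneq k y0; last first.
  by rewrite mxE (negbTE kx) (negbTE ky) mulKf// polar_scale_neq0.
have := polar_slit sz; rewrite polar_radius//;
  rewrite !mxE eqxx (negbTE y0x0) eqxx.
case: sz => /andP[z1 _] /andP[y1 y2].
set r := Num.sqrt _; move=> h; move: y1 y2; set q := z 0 y0 => y1 y2.
have r0 : 0 < r by rewrite sqrtr_gt0; lra.
have pi0 := pi_gt0 R.
have qitv : q * pi / 2 \in `](- (pi / 2)), (pi / 2)[.
  by rewrite in_itv/=; apply/andP; split; nra.
suff -> : r * sin (pi * q) / (r + r * cos (pi * q)) = tan (q * pi / 2).
  have cancel_pi (a : R) : a != 0 -> 2 / a * (q * a / 2) = q by move=> a0;
    field.
  by rewrite tanK// cancel_pi// gt_eqF.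
have ch : 0 < cos (q * pi / 2).
  by rewrite cos_gt0_pihalf//; move: qitv; rewrite in_itv.
have -> : pi * q = (q * pi / 2) *+ 2 by rewrite mulr2n; lra.
rewrite sin_mulr2n cos_mulr2n /tan.
move: (cos _) (sin _) ch => C S C0.
have -> : r + r * (C ^+ 2 *+ 2 - 1) = r * 2 * C ^+ 2 by ring.
by field; rewrite !gt_eqF.
Qed.

Lemma polar_inv_continuous z : strip z -> {for polar z, continuous polar_inv}.
Proof.
move=> sz; have slit := polar_slit sz; move: (polar z) slit => w slit.
have cX k : {for w, continuous (fun v : 'rV[R]_(n + n) =>
  v 0 k)} by exact: coord_continuous.
have cS k : {for w, continuous (fun v : 'rV[R]_(n + n) => v 0 k ^+ 2)}.
  by apply: (@continuous_comp _ _ _ (fun v : 'rV[R]_(n + n) => v 0 k) (fun x =>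
    x ^+ 2)); [exact: cX|exact: exprn_continuous].
have cR : {for w, continuous (fun v : 'rV[R]_(n + n) =>
  v 0 x0 ^+ 2 + v 0 y0 ^+ 2)}.
  apply: (@continuousD R R^o); exact: cS.
apply: continuous_rV => k.
have -> : (fun v => polar_inv v 0 k) = (fun v : 'rV[R]_(n + n) =>
  if k == x0 then 2 * (v 0 x0 ^+ 2 + v 0 y0 ^+ 2) - 1
  else if k == y0 then 2 / pi *
    atan (v 0 y0 / (Num.sqrt (v 0 x0 ^+ 2 + v 0 y0 ^+ 2) + v 0 x0))
  else (polar_scale k)^-1 * v 0 k) by apply/funext => v; rewrite mxE.
have [_|_] := eqVneq k x0.
  apply: (@continuousB R R^o); last exact: cst_continuous.
  by apply: continuousM; first exact: cst_continuous.
have [_|_] := eqVneq k y0.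
  apply: continuousM; first exact: cst_continuous.
  apply: (@continuous_comp _ _ _ _ (@atan R)); last exact: continuous_atan.
  apply: continuousM => //; apply: continuousV; first by rewrite gt_eqF.
  apply: (@continuousD R R^o) => //.
  apply: (@continuous_comp _ _ _ _ (@Num.sqrt R)) => //; exact: sqrt_continuous.
apply: continuousM => //; exact: cst_continuous.
Qed.

End PolarMap.

(** * Polar coordinates are conformally symplectic *)

Section PolarPullback.
Context {R : realType} {n : nat} (n_gt0 : (0 < n)%N).
Implicit Types z w : 'rV[R]_(n + n).

Let x0 : 'I_(n + n) := lshift n (Ordinal n_gt0).
Let y0 : 'I_(n + n) := rshift n (Ordinal n_gt0).

Let y0x0 : (y0 == x0) = false.
Proof. by rewrite /y0 /x0 eq_sym eq_lrshift. Qed.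

(** Only the first pair of coordinates needs an argument: there the determinant
    is [pi * r * r'] with [r ^ 2 = (1 + p) / 2], so that [r * r' = 1 / 4]. *)
Lemma polar_pullback z : strip n_gt0 z ->
  pullback (polar n_gt0) (fun=> (4 / pi) *: std_form R n) z = std_form R n.
Proof.
move=> [/andP[z1 z2] /andP[z3 z4]]; set s : R := Num.sqrt ((1 + z 0 x0) / 2).
have s2 : s ^+ 2 = (1 + z 0 x0) / 2 by rewrite sqr_sqrtr//; lra.
have Ds := is_derive_sqrt_affine z1.
have Dc : is_derive (z 0 y0) 1 (fun q =>
  cos (pi * q)) (- sin (pi * z 0 y0) * pi).
  by apply: is_derive_eq; rewrite /GRing.scale/= ?addr0 ?mulr1.
have Dn : is_derive (z 0 y0) 1 (fun q => sin (pi * q)) (cos (pi * z 0 y0) * pi).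
  by apply: is_derive_eq; rewrite /GRing.scale/= ?addr0 ?mulr1.
have Ls := differentiable_comp_coord Ds.
have Lc := differentiable_comp_coord Dc.
have Ln := differentiable_comp_coord Dn.
have dpolar : forall j, differentiable (fun y => polar n_gt0 y 0 j) z.
  move=> j; rewrite /polar; under eq_fun do rewrite mxE.
  have [_|_] := eqVneq j x0; first exact: differentiableM.
  have [_|_] := eqVneq j y0; first exact: differentiableM.
  by apply: differentiableM => //; exact: differentiable_coord.
have sE : Num.sqrt ((1 + z 0 x0) / 2) = s by [].
have JE i j : jacobian (polar n_gt0) z i j =
    if j == x0 then (i == x0)%:R * (s / (2 * (1 + z 0 x0)) * cos (pi * z 0 y0))
                  - (i == y0)%:R * (s * sin (pi * z 0 y0) * pi)
    else if j == y0 then (i == x0)%:R * (s / (2 * (1 + z 0 x0)) * sin (pi * z 0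
      y0))
                  + (i == y0)%:R * (s * cos (pi * z 0 y0) * pi)
    else (i == j)%:R * polar_scale j.
  rewrite jacobianE// /polar; under eq_fun do rewrite mxE.
  have [_|_] := eqVneq j x0.
    rewrite deriveM; [|exact: diff_derivable|exact: diff_derivable].
    rewrite (derive_comp_coord _ Ds) (derive_comp_coord _ Dc).
    rewrite !mxE eqxx /= !(eq_sym _ i) /GRing.scale/= -/x0 -/y0 sE; ring.
  have [_|_] := eqVneq j y0.
    rewrite deriveM; [|exact: diff_derivable|exact: diff_derivable].
    rewrite (derive_comp_coord _ Ds) (derive_comp_coord _ Dn).
    rewrite !mxE eqxx /= !(eq_sym _ i) /GRing.scale/= -/x0 -/y0 sE; ring.
  rewrite deriveM; [|exact: derivable_cst|apply: diff_derivable;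
    exact: differentiable_coord].
  by rewrite derive_cst derive_coord !mxE eqxx /= (eq_sym _ i) scaler0 addr0
    /GRing.scale/= mulrC.
apply/matrixP => a b; rewrite /pullback -scalemxAr -scalemxAl mxE
  std_form_entry.
rewrite -[std_form R n in RHS]mulmx1 -[X in _ = (X *m _) _ _]mul1mx -[X in _ =
  (_ *m X) _ _]trmx1 std_form_entry.
rewrite mulr_sumr; apply: eq_bigr => l _.
have pi0 : pi != 0 :> R by rewrite gt_eqF// pi_gt0.
rewrite !JE !mxE.
have [->|l0] := eqVneq l (Ordinal n_gt0).
  rewrite -/x0 -/y0 eqxx y0x0 eqxx.
  have := cos2Dsin2 (pi * z 0 y0); move: s2 pi0.
  move: (cos _) (sin _) => C S; move: (pi : R) (z 0 x0) z1;
    move: (s) => r P p p1 r2 P0 CS.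
  have p0 : 1 + p != 0 by lra.
  transitivity (((a == x0)%:R * (b == y0)%:R - (a == y0)%:R * (b == x0)%:R) *
    ((2 * r ^+ 2 / (1 + p)) * (C ^+ 2 + S ^+ 2)) : R).
    by field; rewrite p0 P0.
  rewrite CS r2 mulr1; have -> : 2 * ((1 + p) / 2) / (1 + p) = 1 :> R by field.
  by ring.
have -> : (lshift n l == x0) = false by rewrite (inj_eq (@lshift_inj _ _))
  (negbTE l0).
have -> : (rshift n l == y0) = false by rewrite (inj_eq (@rshift_inj _ _))
  (negbTE l0).
have -> : (rshift n l == x0) = false by rewrite eq_sym eq_lrshift.
have -> : (lshift n l == y0) = false by rewrite eq_lrshift.
rewrite /polar_scale /= ltn_ord ltnNge leq_addr /=.
by move: pi0; move: (pi : R) => P P0; field.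
Qed.

End PolarPullback.

(** * An upper bound for the capacity of a Lagrangian product *)

Definition dotv {R : realType} {n : nat} (u v : 'rV[R]_n) : R := (u *m v^T) 0 0.

Lemma dotvE {R : realType} {n : nat} (u v : 'rV[R]_n) :
  dotv u v = \sum_i u 0 i * v 0 i.
Proof. by rewrite /dotv mxE; apply: eq_bigr => i _; rewrite mxE. Qed.

(** Complete [b] to a basis of linear forms; then correct this frame by the
    transvection that sends the image of [a] to the basis vector [i] and keeps
    [b]. *)
Lemma exists_dual_frame (F : fieldType) n
    (i : 'I_n) (a : 'cV[F]_n) (b : 'rV[F]_n) :
  (b *m a) 0 0 = 1 ->
  exists2 N : 'M[F]_n, N \in unitmx & N *m a = delta_mx i 0 /\ row i N = b.
Proof.
move=> ba1; have b0 : b != 0.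
  by apply: contra_eq_neq ba1 => ->; rewrite mul0mx mxE eq_sym oner_neq0.
pose d : 'rV[F]_n := delta_mx 0 i; pose f : 'M[F]_n := \matrix_k b.
have df : d *m f = b by rewrite -rowE rowK.
have [N0 N0u N0b] : {N0 : 'M[F]_n | N0 \in unitmx & d *m f = d *m N0}.
  by apply: complete_unitmx; rewrite df /row_free rank_rV b0 mxrank_delta.
rewrite df -rowE in N0b.
pose w := N0 *m a; have wi : w i 0 = 1.
  by rewrite -ba1 N0b /w -row_mul [RHS]mxE.
have rw1 : row i w = 1%:M.
  by apply/matrixP => k l; rewrite !ord1 mxE wi mxE.
have dw : d *m (w - delta_mx i 0) = 0.
  rewrite mulmxBr -rowE rw1 mul_delta_mx; apply/matrixP => k l.
  by rewrite !ord1 !mxE subrr.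
move: (w - _) dw (subrK (delta_mx i 0) w) => e de ew.
exists ((1%:M - e *m d) *m N0).
  rewrite unitmx_mul N0u andbT.
  suff /mulmx1_unit[] : (1%:M - e *m d) *m (1%:M + e *m d) = 1%:M by [].
  rewrite mulmxDr mulmx1 mulmxBl mul1mx -mulmxA (mulmxA d) de mul0mx mulmx0
    subr0.
  by rewrite subrK.
split.
  by rewrite -mulmxA -/w mulmxBl mul1mx -mulmxA -rowE rw1 mulmx1 -ew addrC
    addKr.
by rewrite rowE mulmxA mulmxBr mulmx1 mulmxA de mul0mx subr0 -rowE.
Qed.

Section CapacityBound.
Context {R : realType} {n : nat} (n_gt0 : (0 < n)%N).
Variables (c : symplectic_manifold R n -> \bar R).
Hypothesis c_capacity : symplectic_capacity n_gt0 c.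

Let i0 : 'I_n := Ordinal n_gt0.

(** The strip projects onto a square of area 4; the polar coordinates map it to
    the unit cylinder, of capacity [pi], and multiply the form by [pi / 4]. *)
Lemma capacity_strip : (c (domain (@open_strip R n n_gt0)) <= 4%:E)%E.
Proof.
have pi0 := pi_gt0 R.
have a0 : 4 / pi != 0 :> R by rewrite gt_eqF// divr_gt0.
have := capacity_conformal c_capacity (domain (@open_cylinder R n n_gt0)) a0.
rewrite (capacity_cylinder c_capacity) -EFinM ger0_norm ?divr_ge0 ?pi_ge0//.
rewrite divfK ?gt_eqF// => <-; apply: (capacity_monotone c_capacity).
apply: (@domain_embedding _ _ _ _ _ _ (polar n_gt0) (polar_inv n_gt0)).
- exact: polar_smooth.
- exact: polar_cylinder.
- exact: polarK.
- exact: polar_inv_continuous.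
- exact: polar_pullback.
Qed.

Variables (K L : set 'rV[R]_n) (u v : 'rV[R]_n) (al be : R).
Hypothesis uv_gt0 : 0 < dotv u v.
Hypothesis al_gt0 : 0 < al.
Hypothesis be_gt0 : 0 < be.
Hypothesis K_slab : forall x, K x -> `|dotv x u| < al.
Hypothesis L_slab : forall y, L y -> `|dotv y v| < be.

(** The block-diagonal map below is linear and conformally symplectic, with
    first coordinates [<x, u> / al] and [<y, v> / be]; it maps the product into
    the strip. *)
Lemma capacity_lagrangian_product_le :
  (capacity_body c (lagrangian_product K L) <= (4 * al * be / dotv u v)%:E)%E.
Proof.
(* Conformal factor: the area of the rectangle is [4 / k]. *)
pose k := dotv u v / (al * be); have k0 : 0 < k by rewrite divr_gt0// mulr_gt0.
have [N Nu [Na Nb]] : exists2 N : 'M[R]_n, N \in unitmx &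
    N *m (al^-1 *: u^T) = delta_mx i0 0 /\ row i0 N = (al / dotv u v) *: v.
  apply: exists_dual_frame; rewrite -scalemxAl -scalemxAr scalerA mxE.
  have -> : (v *m u^T) 0 0 = dotv u v by rewrite -[LHS]/(dotv v u) !dotvE;
    apply: eq_bigr => ? _; rewrite mulrC.
  by field; rewrite !gt_eqF.
pose P := invmx N; pose Q := k *: N^T.
pose A : 'M[R]_(n + n) := block_mx P 0 0 Q.
have PQ : P *m Q^T = k%:M by rewrite linearZ/= trmxK -scalemxAr mulVmx//
  scalemx1.
have Au : A \in unitmx.
  rewrite unitmxE det_ublock unitrM -!unitmxE unitmx_inv Nu /Q.
  by rewrite unitmxZ ?unitmx_tr// unitfE gt_eqF.
have Asym : A *m std_form R n *m A^T = k *: std_form R n.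
  rewrite /A /std_form tr_block_mx !mulmx_block !trmx0 !mulmx0 !mul0mx !addr0
    !add0r.
  have QP : Q *m P^T = k%:M by rewrite -[LHS]trmxK trmx_mul trmxK PQ
    tr_scalar_mx.
  by rewrite !mul0mx mulmxN !mulmx1 mulNmx PQ QP scale_block_mx !scaler0 scalerN
    scalemx1.
have kV0 : k^-1 != 0 by rewrite invr_neq0// gt_eqF.
have -> : (4 * al * be / dotv u v)%:E = (`|k^-1|%:E * 4%:E)%E.
  rewrite -EFinM ger0_norm ?invr_ge0 1?ltW//; congr _%:E; rewrite /k.
  by field; rewrite !gt_eqF.
apply: (@le_trans _ _ (`|k^-1|%:E * c (domain (@open_strip R n n_gt0)))%E);
  last first.
  by apply: lee_wpmul2l; [rewrite lee_fin normr_ge0|exact: capacity_strip].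
rewrite -(capacity_conformal c_capacity _ kV0);
  apply: (capacity_monotone c_capacity).
apply: (@domain_embedding _ _ _ _ _ _ (fun z => z *m A) (fun z =>
  z *m invmx A)).
- apply: smooth_mulmxr; exact: open_interior.
- move=> z /interior_subset[Kz Lz].
  have zA : z *m A = row_mx (lsubmx z *m P) (rsubmx z *m Q).
    by rewrite -{1}[z]hsubmxK mul_row_block !mulmx0 addr0 add0r.
  have cP : col i0 P = al^-1 *: u^T.
    by rewrite colE -Na mulmxA mulVmx// mul1mx.
  have cQ : col i0 Q = be^-1 *: v^T.
    rewrite /Q; apply/colP => j; have /rowP/(_ j) := Nb; rewrite !mxE => ->.
    by rewrite /k; field; rewrite !gt_eqF.
  have eP (x : 'rV[R]_n) : (x *m P) 0 i0 = dotv x u / al.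
    have -> : (x *m P) 0 i0 = (col i0 (x *m P)) 0 0 by rewrite [RHS]mxE.
    by rewrite colE -mulmxA -colE cP -scalemxAr mxE mulrC.
  have eQ (x : 'rV[R]_n) : (x *m Q) 0 i0 = dotv x v / be.
    have -> : (x *m Q) 0 i0 = (col i0 (x *m Q)) 0 0 by rewrite [RHS]mxE.
    by rewrite colE -mulmxA -colE cQ -scalemxAr mxE mulrC.
  rewrite /strip /= zA row_mxEl row_mxEr -/i0 eP eQ -!ltr_norml !normrM !normfV.
  by rewrite !(gtr0_norm al_gt0) !(gtr0_norm be_gt0) !ltr_pdivrMr// !mul1r;
    split; [exact: K_slab|exact: L_slab].
- by move=> z _; rewrite mulmxK.
- by move=> z _; exact: continuous_mulmxr.
- move=> z _; rewrite /pullback jacobian_mulmxr -scalemxAr -scalemxAl Asym.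
  by rewrite scalerA mulVf ?scale1r// gt_eqF.
Qed.

End CapacityBound.

(** * Convex sets, separation and the polar body *)

Section DotProduct.
Context {R : realType} {n : nat}.
Implicit Types (u v w x y : 'rV[R]_n) (a : R).

Lemma dotvC u v : dotv u v = dotv v u.
Proof. by rewrite !dotvE; apply: eq_bigr => i _; rewrite mulrC. Qed.

Lemma dotvDl u v w : dotv (u + v) w = dotv u w + dotv v w.
Proof. by rewrite /dotv mulmxDl mxE. Qed.

Lemma dotvZl a u w : dotv (a *: u) w = a * dotv u w.
Proof. by rewrite /dotv -scalemxAl mxE. Qed.

Lemma dotvNl u w : dotv (- u) w = - dotv u w.
Proof. by rewrite /dotv mulNmx mxE. Qed.

Lemma dotvDr u v w : dotv w (u + v) = dotv w u + dotv w v.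
Proof. by rewrite dotvC dotvDl !(dotvC w). Qed.

Lemma dotvZr a u w : dotv w (a *: u) = a * dotv w u.
Proof. by rewrite dotvC dotvZl dotvC. Qed.

Lemma dotvNr u w : dotv w (- u) = - dotv w u.
Proof. by rewrite dotvC dotvNl dotvC. Qed.

Lemma dotvv_ge0 u : 0 <= dotv u u.
Proof. by rewrite dotvE; apply: sumr_ge0 => i _; rewrite -expr2 sqr_ge0. Qed.

Lemma dotvv_gt0 u : u != 0 -> 0 < dotv u u.
Proof.
move=> u0; rewrite lt_neqAle dotvv_ge0 andbT eq_sym; apply: contra u0.
rewrite dotvE psumr_eq0; last by move=> i _; rewrite -expr2 sqr_ge0.
move=> /allP uE; apply/eqP/rowP => i; rewrite mxE.
by have := uE i (mem_index_enum _); rewrite mulf_eq0 orbb => /eqP.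
Qed.

Lemma continuous_dotvl w : continuous (fun x => dotv x w : R).
Proof.
have -> : (fun x => dotv x w : R) = (fun x => \sum_i x 0 i * w 0 i).
  by apply/funext => x; rewrite dotvE.
have C : Ck_on 0 setT (fun x : 'rV[R]_n => \sum_i x 0 i * w 0 i).
  apply: Ck_on_sum; first exact: openT.
  move=> i; apply: Ck_onM; [exact: openT|exact: smooth_on_coord|exact:
    Ck_on_cst].
by move=> x; case: C => C _; apply: C; exact: mem_set.
Qed.

Lemma continuous_dotvv : continuous (fun x => dotv x x : R).
Proof.
have -> : (fun x => dotv x x : R) = (fun x => \sum_i x 0 i * x 0 i).
  by apply/funext => x; rewrite dotvE.
have C : Ck_on 0 setT (fun x : 'rV[R]_n => \sum_i x 0 i * x 0 i).
  apply: Ck_on_sum; first exact: openT.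
  by move=> i; apply: Ck_onM; [exact: openT|exact: smooth_on_coord|exact:
    smooth_on_coord].
by move=> x; case: C => C _; apply: C; exact: mem_set.
Qed.

End DotProduct.

Section Convex.
Context {R : realType} {n : nat}.
Implicit Types (K L : set 'rV[R]_n) (u v w x y : 'rV[R]_n).

Definition convex K := convex_set (K : set (convex_lmodType 'rV[R]_n)).

Lemma convex_seg K x y (t : R) : convex K -> K x -> K y -> 0 <= t <= 1 ->
  K (t *: x + (1 - t) *: y).
Proof.
move=> cK Kx Ky /andP[t0 t1].
by have := cK x y (Itv01 t0 t1) (mem_set Kx) (mem_set Ky); rewrite inE.
Qed.

(** With [0] in [K], weights of sum at most [1] suffice. *)
Lemma convex_sum K (I : Type) (r : seq I) (l : I -> R) (p : I -> 'rV[R]_n) :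
  convex K -> K 0 -> (forall i, 0 <= l i) -> (forall i, K (p i)) ->
  \sum_(i <- r) l i <= 1 -> K (\sum_(i <- r) l i *: p i).
Proof.
move=> cK K0 l0 Kp l1.
suff [z Kz ->] : exists2 z, K z & \sum_(i <- r) l i *: p i = (\sum_(i <- r) l i)
  *: z.
  rewrite -[X in K X]addr0 -[in X in K (_ + X)](scaler0 _ (1 - \sum_(i <- r) l
    i)).
  by apply: convex_seg => //; rewrite l1 sumr_ge0.
elim: r {l1} => [|i r [z Kz IH]]; first by exists 0 => //;
  rewrite big_nil scaler0.
rewrite !big_cons IH; set S := \sum_(j <- r) l j.
have S0 : 0 <= S by exact: sumr_ge0.
have [l00|lS] := eqVneq (l i + S) 0.
  have /eqP := l00; rewrite paddr_eq0// => /andP[/eqP -> /eqP ->].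
  by exists 0 => //; rewrite scaler0 !scale0r addr0.
have lS0 : 0 < l i + S by rewrite lt_neqAle eq_sym lS addr_ge0.
exists ((l i / (l i + S)) *: p i + (1 - l i / (l i + S)) *: z).
  apply: convex_seg => //; rewrite divr_ge0//= ?(ltW lS0)//.
  by rewrite ler_pdivrMr// mul1r lerDl.
rewrite scalerDr !scalerA; congr (_ *: _ + _ *: _); first by field.
by field.
Qed.

Lemma compact_dotv_lt K u : compact K ->
  exists2 M, 0 < M & forall x, K x -> `|dotv x u| < M.
Proof.
move=> cK; have [[x0 Kx0]|K0] := pselect (K !=set0); last first.
  by exists 1 => // x Kx; case: K0; exists x.
have [|z _ zmax] := EVT_max_rV (f :=
  fun x => `|dotv x u|) (ex_intro _ x0 Kx0) cK.
  apply: continuous_subspaceT => x.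
  apply: (@continuous_comp _ _ _ (fun x => dotv x u) Num.norm).
    exact: continuous_dotvl.
  exact: norm_continuous.
exists (`|dotv z u| + 1); first by rewrite ltr_wpDl.
by move=> x Kx; rewrite ltr_pwDr// zmax// inE.
Qed.

(** The normal is the vector from the nearest point of [L] to [q]. *)
Lemma separation L q : compact L -> convex L -> L !=set0 -> ~ L q ->
  exists v b, (forall y, L y -> dotv y v <= b) /\ b < dotv q v.
Proof.
move=> cL vL L0 Lq.
have [|y0 Ly0 ymin] := EVT_min_rV (f := fun y => dotv (y - q) (y - q)) L0 cL.
  apply: continuous_subspaceT => x.
  apply: (@continuous_comp _ _ _ (fun x => x - q) (fun x => dotv x x)).
    by apply: continuousB; [exact: cvg_id|exact: cst_continuous].
  exact: continuous_dotvv.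
have {}Ly0 := set_mem Ly0.
exists (q - y0), (dotv y0 (q - y0)); split; last first.
  rewrite -subr_gt0 -dotvNl -dotvDl; apply: dotvv_gt0; rewrite subr_eq0.
  by apply: contra_notN Lq => /eqP ->.
move=> y Ly; rewrite -subr_le0 -dotvNl -dotvDl; apply/ler_addgt0Pr => e e0.
rewrite add0r; set d := y - y0; set w := q - y0.
have D0 := dotvv_ge0 d.
(* Minimality along the segment from [y0] to [y], at a time of order [e]. *)
pose t := Order.min 1 (e / (dotv d d + 1)).
have t0 : 0 < t by rewrite lt_min ltr01 divr_gt0// ltr_wpDl.
have t1 : t <= 1 by rewrite ge_min lexx.
have te : t * (dotv d d + 1) <= e.
  by rewrite -ler_pdivlMr ?ltr_wpDl// ge_min lexx orbT.
have := ymin (t *: y + (1 - t) *: y0).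
rewrite inE => /(_ (convex_seg vL Ly Ly0 _)); rewrite t1 ltW// => /(_ isT).
have -> : t *: y + (1 - t) *: y0 - q = t *: d - w.
  by rewrite /d /w scalerBr scalerBl scale1r opprB !addrA; congr (_ - _);
    rewrite addrAC -addrA addrCA addrC; congr (_ + _); rewrite addrC.
have -> : y0 - q = - w by rewrite /w opprB.
clearbody d w.
rewrite !(dotvDl, dotvDr, dotvZl, dotvZr, dotvNl,
  dotvNr) (dotvC w d) !opprK => H.
have H2 : t * (2 * dotv d w) <= t * (t * dotv d d) by lra.
rewrite ler_pM2l// in H2; nra.
Qed.

Definition polar_body K : set 'rV[R]_n :=
  [set u | forall x, K x -> dotv x u <= 1].

End Convex.

Section CapacityPolar.
Context {R : realType} {n : nat} (n_gt0 : (0 < n)%N).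
Variables (c : symplectic_manifold R n -> \bar R).
Hypothesis c_capacity : symplectic_capacity n_gt0 c.
Variables (K L : set 'rV[R]_n).
Hypotheses (K_compact : compact K) (K_sym : forall x, K x -> K (- x)).
Hypotheses (L_compact : compact L) (L_convex : convex L).
Hypothesis L_sym : forall x, L x -> L (- x).
Hypothesis L_neq0 : L !=set0.

Lemma capacity_lagrangian_fin_num :
  capacity_body c (lagrangian_product K L) \is a fin_num.
Proof.
pose u : 'rV[R]_n := const_mx 1.
have [al al0 Kal] := compact_dotv_lt u K_compact.
have [be be0 Lbe] := compact_dotv_lt u L_compact.
have u0 : 0 < dotv u u.
  apply: dotvv_gt0; apply/eqP => /rowP/(_ (Ordinal n_gt0));
    rewrite !mxE => /eqP.
  by rewrite oner_eq0.
rewrite ge0_fin_numE; last exact: (capacity_ge0 c_capacity).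
apply: le_lt_trans (capacity_lagrangian_product_le c_capacity u0 al0 be0 Kal
  Lbe) _.
exact: ltey.
Qed.

(** If the point were outside of [L], a separating functional [v] would give
    bounds [al], slightly above [1], and [be], slightly above the supremum of
    [v] on [L], with [4 * al * be / <u, v> < r], against the capacity estimate.
    *)
Lemma dilate_polar_sub (r : R) u : 0 <= r ->
  (r%:E <= capacity_body c (lagrangian_product K L))%E ->
  polar_body K u -> L ((r / 4) *: u).
Proof.
move=> r0 rc Ku; apply: contrapT => nL.
have [v [b [Lb bq]]] := separation L_compact L_convex L_neq0 nL.
have [y0 Ly0] := L_neq0.
have b0 : 0 <= b.
  have := Lb _ (L_sym Ly0); have := Lb _ Ly0; rewrite dotvNl; lra.
rewrite dotvZl in bq.
have uv0 : 0 < dotv u v by nra.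
have rgt0 : 0 < r by nra.
pose be := (b + r / 4 * dotv u v) / 2.
have be1 : b < be by rewrite /be; lra.
have be2 : be < r / 4 * dotv u v by rewrite /be; lra.
have be0 : 0 < be by lra.
pose al := (1 + r / 4 * dotv u v / be) / 2.
have q1 : 1 < r / 4 * dotv u v / be by rewrite ltr_pdivlMr// mul1r.
have al1 : 1 < al by rewrite /al; lra.
have al0 : 0 < al by lra.
have al2 : al < r / 4 * dotv u v / be by rewrite /al; lra.
have Kal x : K x -> `|dotv x u| < al.
  move=> Kx; apply: le_lt_trans al1; rewrite ler_norml.
  by have := Ku _ (K_sym Kx); have := Ku _ Kx; rewrite dotvNl => -> ?;
    rewrite lerNl andbT.
have Lbe y : L y -> `|dotv y v| < be.
  move=> Ly; apply: le_lt_trans be1; rewrite ler_norml.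
  by have := Lb _ (L_sym Ly); have := Lb _ Ly; rewrite dotvNl => -> ?;
    rewrite lerNl andbT.
have := le_trans rc (capacity_lagrangian_product_le c_capacity uv0 al0 be0 Kal
  Lbe).
rewrite lee_fin; apply/negP; rewrite -ltNge ltr_pdivrMr//.
move: al2; rewrite ltr_pdivlMr// => al2; nra.
Qed.

End CapacityPolar.

(** * Lattice points and volume *)

Definition lattice_point {R : realType} {m : nat}
    (eps : R) (p : 'rV[int]_m) : 'rV[R]_m :=
  \row_i (eps * (p 0 i)%:~R).

Section Lattice.
Context {R : realType} {m : nat}.
Implicit Types (a b : 'rV[R]_m) (A : set 'rV[R]_m).

(** In each coordinate the integer points between [a / eps] and [b / eps] number
    at most [(b - a) / eps + 1]. *)
Lemma card_lattice_box (T : finType) (f : T -> 'rV[int]_m) (eps : R) a b :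
  injective f -> 0 < eps -> (forall t, box a b (lattice_point eps (f t))) ->
  #|T|%:R * eps ^+ m <= \prod_i (Num.max 0 (b 0 i - a 0 i) + eps).
Proof.
move=> finj e0 fab.
have [t0 _|T0] := pickP (@predT T); last first.
  rewrite (eq_card0 T0) mul0r; apply: prodr_ge0 => i _.
  by apply: addr_ge0; [rewrite le_max lexx|exact: ltW].
pose lo i := Num.ceil (a 0 i / eps); pose hi i := Num.floor (b 0 i / eps).
have fi t i : lo i <= f t 0 i <= hi i.
  have := fab t i; rewrite mxE => /andP[fa fb].
  by apply/andP; split; [rewrite ceil_le_int ler_pdivrMr// mulrC|rewrite
    floor_ge_int ler_pdivlMr// mulrC].
pose N i := `|(hi i - lo i)%R|%N.
have NE i : (N i)%:~R = (hi i)%:~R - (lo i)%:~R :> R.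
  have /andP[h1 h2] := fi t0 i.
  by rewrite /N -intrB -[in RHS](@gez0_abs (hi i - lo i)) ?subr_ge0 ?(le_trans
    h1).
pose g t : {dffun forall i : 'I_m, 'I_(N i).+1} :=
  [ffun i => inord `|(f t ord0 i - lo i)%R|%N].
have ginj : injective g.
  move=> s t /ffunP gst; apply: finj; apply/rowP => i.
  have := gst i; rewrite !ffunE => /(congr1 val) /=.
  have H r : (`|(f r ord0 i - lo i)%R|%N < (N i).+1)%N.
    rewrite ltnS /N -lez_nat; have /andP[h1 h2] := fi r i.
    by rewrite !gez0_abs ?subr_ge0 ?(le_trans h1)// lerB.
  rewrite !inordK// => /(congr1 Posz).
  have /andP[hs _] := fi s i; have /andP[ht _] := fi t i.
  by rewrite !gez0_abs ?subr_ge0// => /addIr.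
have := leq_card g ginj; rewrite card_dep_ffun.
rewrite foldrE big_map big_enum /= => cT.
rewrite -[m in eps ^+ m]card_ord -prodr_const.
apply: (@le_trans _ _ ((\prod_(i < m) (N i).+1)%:R * \prod_(i < m) eps)).
  apply: ler_wpM2r; first by rewrite prodr_ge0// => i _; exact: ltW.
  by rewrite ler_nat (leq_trans cT)//; apply: eq_leq; apply: eq_bigr => i _;
    rewrite card_ord.
rewrite natr_prod -big_split /=; apply: ler_prod => i _.
rewrite mulr_ge0 ?ler0n ?(ltW e0)//= -natr1 mulrDl mul1r lerD2r.
rewrite le_max; apply/orP; right;
  rewrite -[(N i)%:R]/((N i)%:~R) NE mulrBl lerB//.
  by rewrite -ler_pdivlMr//; exact: floor_le.
by rewrite -ler_pdivrMr//; exact: ceil_ge.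
Qed.

Lemma prod_enlarge (w : 'I_m -> R) (d : R) : 0 < d ->
  exists2 h : R, 0 < h & \prod_i (w i + h) <= \prod_i w i + d.
Proof.
move=> d0; pose F (x : R) := \prod_i (w i + x).
have cF : continuous F.
  apply: (@continuous_big R _ *%R 1 xpredT) => [|i _ x];
    first exact: mul_continuous.
  by apply: (@continuousD R R^o); [exact: cst_continuous|exact: cvg_id].
have /cvgrPdist_lt/(_ _ d0) := cF 0.
move=> /nbhs_ballP[e /= e0 He]; exists (e / 2); first by rewrite divr_gt0.
have : ball 0 e (e / 2) by rewrite /ball /= sub0r normrN gtr0_norm ?divr_gt0//
  ltr_pdivrMr// ltr_pMr// ltr1n.
move=> /He /=; rewrite /F; under eq_bigr do rewrite addr0.
by rewrite ltr_distlC => /andP[_ /ltW].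
Qed.

Definition open_box a b : set 'rV[R]_m :=
  [set x | forall i, a 0 i < x 0 i < b 0 i].

Lemma open_open_box a b : open (open_box a b).
Proof.
rewrite openE => x abx; rewrite /interior.
apply: (@filter_forall _ _ (fun i =>
  [set x : 'rV[R]_m | a 0 i < x 0 i < b 0 i]) (nbhs x) (nbhs_filter x)) => i.
apply: open_nbhs_nbhs; split; last exact: abx.
rewrite (_ : [set _ | _] = (fun x : 'rV[R]_m => x 0 i) @^-1` `]a 0 i,
  b 0 i[%classic); last first.
  by apply/seteqP; split=> z /=; rewrite in_itv.
by apply: open_comp; [move=> z _; exact: coord_continuous|exact: itv_open].
Qed.

(** Take a cover by boxes of total volume close to the infimum, enlarge the
    boxes to open ones at a cost summing to [d / 2], and extract a finite
    subcover. Once [eps] is smaller than all the enlargements in it, the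
    counting error of each box is absorbed by its enlargement. *)
Lemma volume_ge_lattice A (d : R) : compact A -> 0 < d ->
  exists2 e0 : R, 0 < e0 & forall eps, 0 < eps <= e0 ->
  forall (T : finType) (f : T -> 'rV[int]_m), injective f ->
    (forall t, A (lattice_point eps (f t))) ->
  ((#|T|%:R * eps ^+ m)%:E <= volume A + d%:E)%E.
Proof.
move=> cA d0; have bv0 a b : 0 <= box_volume a b.
  by apply: prodr_ge0 => i _; rewrite le_max lexx.
have v0 : (0 <= volume A)%E.
  apply: le_ereal_inf_tmp => _ [F _ <-]; apply: nneseries_ge0 => k _ _.
  by rewrite lee_fin.
have [vy|vfin] := eqVneq (volume A) +oo%E.
  by exists 1 => // eps _ T f _ _; rewrite vy addye// leey.
have {}vfin : volume A \is a fin_num by rewrite ge0_fin_numE// ltey.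
have d2 : 0 < d / 2 by rewrite divr_gt0.
have [_ [F AF <-] Fv] := lb_ereal_inf_adherent d2 vfin.
pose w k (i : 'I_m) := Num.max 0 ((F k).2 0 i - (F k).1 0 i).
have /choice[h hP] : forall k, exists h : R, 0 < h /\
    \prod_i (w k i + h) <= \prod_i w k i + d / 2 * 2^-1 ^+ k.+1.
  move=> k; have [|h h0 hw] := @prod_enlarge (w k) (d / 2 * 2^-1 ^+ k.+1).
    by rewrite mulr_gt0// exprn_gt0// invr_gt0.
  by exists h.
have h3 k : 0 < h k / 3 by rewrite divr_gt0//; case: (hP k).
pose lo k : 'rV[R]_m := \row_i ((F k).1 0 i - h k / 3).
pose hi k : 'rV[R]_m := \row_i ((F k).2 0 i + h k / 3).
have : finite_subset_cover [set: nat] (fun k => open_box (lo k) (hi k)) A.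
  move: cA; rewrite compact_cover; apply=> [k _|x Ax];
    first exact: open_open_box.
  have [k _ Fx] := AF x Ax; exists k => // i; rewrite !mxE.
  have /andP[Fa Fb] := Fx i.
  by rewrite ltrBlDr (le_lt_trans Fa) ?ltrDl//= (le_lt_trans Fb)// ltrDl.
move=> [D _ AD].
pose N := (\max_(k <- finmap.enum_fset D) k).+1.
have AN x : A x -> exists k : 'I_N, open_box (lo k) (hi k) x.
  move=> /AD[k kD xk]; have kN : (k < N)%N by rewrite ltnS;
    exact: leq_bigmax_seq.
  by exists (Ordinal kN).
have /choice[g gP] : forall x, exists k : 'I_N, A x -> open_box (lo k) (hi k) x.
  move=> x; have [/AN[k kx]|nA] := pselect (A x); first by exists k.
  by exists ord0.
(* A third of the enlargement goes to the open box on each side, the last third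
   to the counting error. *)
exists (\big[Order.min/1]_(k < N) (h k / 3)).
  by apply: lt_bigmin => // k _; exact: h3.
move=> eps /andP[e0 eh] T f finj fA.
pose c t := g (lattice_point eps (f t)).
have cardT : #|T|%:R = \sum_(k < N) #|{: {t : T | c t == k}}|%:R :> R.
  rewrite -natr_sum; congr _%:R; rewrite -sum1_card (partition_big c predT)//=.
  by apply: eq_bigr => k _; rewrite card_sig sum1_card.
have boxk (k : 'I_N) : #|{: {t : T | c t == k}}|%:R * eps ^+ m <=
    box_volume (F k).1 (F k).2 + d / 2 * 2^-1 ^+ k.+1.
  have ehk : eps <= h k / 3 by apply: (le_trans eh); exact: bigmin_le_cond.
  have [_ hk] := hP k; apply: le_trans hk.
  apply: (@le_trans _ _ (\prod_i (Num.max 0 (hi k 0 i - lo k 0 i) + eps))).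
    apply: (@card_lattice_box _ (fun t => f (val t))) => //.
      by move=> s t /finj /val_inj.
    move=> [t /= /eqP tk] i; have := gP _ (fA t);
      rewrite -/(c t) tk => /(_ i)/andP[h1 h2].
    by rewrite !ltW.
  apply: ler_prod => i _; rewrite addr_ge0 ?le_max ?lexx ?(ltW e0)//= !mxE.
  have w0 : 0 <= w k i by rewrite le_max lexx.
  have w1 : (F k).2 0 i - (F k).1 0 i <= w k i by rewrite le_max lexx orbT.
  have := h3 k => h30.
  by rewrite -lerBrDr ge_max; apply/andP; split; lra.
have geom M : \sum_(k < M) (d / 2 * 2^-1 ^+ k.+1) = d / 2 * (1 - 2^-1 ^+ M).
  elim: M => [|M IH]; first by rewrite big_ord0 expr0 subrr mulr0.
  by rewrite big_ord_recr /= IH exprS; field.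
have Tle : #|T|%:R * eps ^+ m <= \sum_(k < N) box_volume (F k).1 (F k).2 + d /
  2.
  rewrite cardT mulr_suml (le_trans (ler_sum _ (fun k _ => boxk k)))//.
  rewrite big_split /= lerD2l geom ger_pMr// gerDl oppr_le0 exprn_ge0//
    invr_ge0//.
apply: (@le_trans _ _ ((\sum_(k < N) box_volume (F k).1 (F k).2 + d / 2)%:E)).
  by rewrite lee_fin.
rewrite EFinD [in leRHS](splitr d) EFinD addeA leeD2r//.
apply: le_trans (ltW Fv).
apply: le_trans (nneseries_lim_ge N _); last by move=> k _ _; rewrite lee_fin.
by rewrite big_mkord sumEFin.
Qed.

End Lattice.

(** * The rotation group of the cross-polytope *)

Section SignedPermutations.
Context {R : realType} {n : nat}.
Implicit Types (s : 'S_n) (e : 'I_n -> bool) (x u : 'rV[R]_n).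

Definition signed_perm s e x : 'rV[R]_n := \row_i ((-1) ^+ e i * x 0 (s i)).

(** The determinant of the signed permutation matrix. *)
Definition signed_perm_det s e : R := (-1) ^+ s * \prod_i (-1) ^+ e i.

Definition signed_perm_mx s e : 'M[R]_n :=
  diag_mx (\row_i (-1) ^+ e i) *m perm_mx s.

Lemma signed_perm_mx_entry s e i j :
  signed_perm_mx s e i j = (-1) ^+ e i * (s i == j)%:R.
Proof. by rewrite /signed_perm_mx mul_diag_mx !mxE. Qed.

Lemma signed_perm_mxE s e x : x *m (signed_perm_mx s e)^T = signed_perm s e x.
Proof.
apply/rowP => i; rewrite !mxE (bigD1 (s i))//= big1 => [|j ji].
  by rewrite addr0 mxE signed_perm_mx_entry eqxx mulr1 mulrC.
by rewrite mxE signed_perm_mx_entry eq_sym (negbTE ji) !mulr0.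
Qed.

Lemma signed_perm_mx_orth s e : signed_perm_mx s e *m (signed_perm_mx s e)^T =
  1%:M.
Proof.
rewrite /signed_perm_mx trmx_mul tr_perm_mx tr_diag_mx mulmxA -(mulmxA (diag_mx
  _)).
rewrite -perm_mxM mulgV perm_mx1 mulmx1 mulmx_diag.
apply/matrixP => i j; rewrite !mxE; case: (i == j) => //.
by rewrite !mulr1n -signr_addb addbb.
Qed.

Lemma signed_perm_mx_det s e : \det (signed_perm_mx s e) = signed_perm_det s e.
Proof.
rewrite det_mulmx det_diag det_perm mulrC; congr (_ * _).
by apply: eq_bigr => i _; rewrite mxE.
Qed.

(** The vectors mapped into the cross-polytope form a convex set, so it is
    enough to check its vertices. *)
Lemma cross_polytope_sub (M : 'M[R]_n) :
  (forall i, exists (b : bool) j, row i M = (-1) ^+ b *: delta_mx 0 j) ->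
  forall x, cross_polytope x -> cross_polytope (x *m M).
Proof.
move=> HM x Hx; apply: (Hx [set y | cross_polytope (y *m M)]);
  split=> [y z l|y [i Hy]].
  move=> /set_mem Cy /set_mem Cz; apply/mem_set => C [vC gC].
  have := vC (y *m M) (z *m M) l (mem_set (Cy C (conj vC gC))) (mem_set (Cz C
    (conj vC gC))).
  move=> /set_mem; rewrite /convex.conv /=.
  by rewrite mulmxDl -!scalemxAl.
move=> C [vC gC]; apply: gC.
have [b [j Mij]] := HM i; rewrite rowE in Mij.
exists j; case: Hy => ->; rewrite ?mulNmx Mij; case: b {Mij};
  rewrite ?expr1 ?expr0 ?scaleN1r ?scale1r ?opprK; tauto.
Qed.

Lemma signed_perm_mx_SO s e : signed_perm_det s e = 1 ->
  SO_cross_polytope (signed_perm_mx s e).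
Proof.
move=> se1; have orth := signed_perm_mx_orth s e; have orth' := mulmx1C orth.
split; first by split=> //; rewrite signed_perm_mx_det.
apply/seteqP; split=> [_ [x Cx <-]|x Cx].
  apply: cross_polytope_sub Cx => i.
  exists (e ((s^-1)%g i)), ((s^-1)%g i); apply/rowP => j.
  rewrite 2!mxE signed_perm_mx_entry !mxE eqxx /=.
  have [->|ji] := eqVneq j ((s^-1)%g i); first by rewrite permKV eqxx.
  by rewrite (canF_eq (permK s)) (negbTE ji) !mulr0.
exists (x *m signed_perm_mx s e); last by rewrite -mulmxA orth mulmx1.
apply: cross_polytope_sub Cx => i; exists (e i), (s i); apply/rowP => j.
by rewrite mxE signed_perm_mx_entry !mxE eqxx /= eq_sym.
Qed.

(** Invariance under the group of the cross-polytope, in terms of coordinates: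
    its rotations are the signed permutations of determinant 1. *)
Definition so_invariant (K : set 'rV[R]_n) :=
  forall s e x, signed_perm_det s e = 1 -> K x -> K (signed_perm s e x).

Lemma so_invariant_of_image (K : set 'rV[R]_n) :
  (forall g, SO_cross_polytope g -> mx_image g K = K) -> so_invariant K.
Proof.
move=> KI s e x se1 Kx; rewrite -(KI _ (signed_perm_mx_SO se1)).
by exists x => //; rewrite signed_perm_mxE.
Qed.

Lemma dotv_signed_perm s e x u :
  dotv x (signed_perm s e u) = dotv (signed_perm (s^-1)%g (e \o (s^-1)%g) x) u.
Proof.
rewrite !dotvE (reindex_inj (@perm_inj _ (s^-1)%g)) /=; apply: eq_bigr => i _.
by rewrite !mxE permKV /=; ring.
Qed.

Lemma signed_perm_det_inv s e : signed_perm_det (s^-1)%g (e \o (s^-1)%g) =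
  signed_perm_det s e.
Proof.
rewrite /signed_perm_det odd_permV [in RHS](reindex_inj (@perm_inj _ (s^-1)%g))
  /=.
by [].
Qed.

Lemma so_invariant_polar (K : set 'rV[R]_n) :
  so_invariant K -> so_invariant (polar_body K).
Proof.
move=> KI s e u se1 Ku x Kx; rewrite dotv_signed_perm; apply: Ku.
by apply: KI => //; rewrite signed_perm_det_inv.
Qed.

Lemma signed_perm_opp x : signed_perm 1%g (fun=> true) x = - x.
Proof. by apply/rowP => i; rewrite !mxE perm1 expr1 mulN1r. Qed.

(** The opposite is a rotation in even dimension. *)
Lemma so_invariant_opp (K : set 'rV[R]_n) x : ~~ odd n -> so_invariant K ->
  K x -> K (- x).
Proof.
move=> nev KI Kx; rewrite -signed_perm_opp; apply: KI => //.
rewrite /signed_perm_det odd_perm1 expr0 mul1r prodr_const card_ord expr1.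
by rewrite -signr_odd (negbTE nev).
Qed.

(** The barycentres of the faces of the cross-polytope are the signed
    permutations of these vectors, up to scaling. *)
Definition init_ind k : 'rV[R]_n := \row_i (i < k)%:R.

Lemma dotv_init_ind x k : dotv x (init_ind k) = \sum_(i < n | (i < k)%N) x 0 i.
Proof.
rewrite dotvE [RHS]big_mkcond; apply: eq_bigr => i _; rewrite mxE.
by case: ifP => _; rewrite ?mulr1 ?mulr0.
Qed.

Lemma dotv_signed_perm_self s e x : dotv (signed_perm s e x) (signed_perm s e x)
  = dotv x x.
Proof.
rewrite !dotvE [RHS](reindex_inj (@perm_inj _ s)) /=; apply: eq_bigr => i _.
by rewrite !mxE mulrACA -expr2 sqrr_sign mul1r.
Qed.

Lemma dotv_signed_perm_ind s e x k :
  (forall i : 'I_n, (s i < k)%N = (i < k)%N) -> (forall i : 'I_n, (i < k)%N ->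
    e i = false) ->
  dotv (signed_perm s e x) (init_ind k) = dotv x (init_ind k).
Proof.
move=> sk ek; rewrite !dotv_init_ind [RHS](reindex_inj (@perm_inj _ s)) /=.
by apply: eq_big => [i|i ik]; rewrite ?sk// mxE ek// mul1r.
Qed.

End SignedPermutations.

Section Averaging.
Context {R : realType} {n : nat} (n_gt2 : (2 < n)%N).
Variable K : set 'rV[R]_n.
Hypotheses (K_compact : compact K) (K_convex : convex K) (K_inv : so_invariant
  K).

Lemma prod_sign1 (i : 'I_n) : \prod_j (-1) ^+ (j == i) = -1 :> R.
Proof.
rewrite (bigD1 i)//= eqxx expr1 big1 ?mulr1// => j /negbTE ->.
by rewrite expr0.
Qed.

Lemma prod_sign2 (i i' : 'I_n) : i != i' ->
  \prod_j (-1) ^+ ((j == i) || (j == i')) = 1 :> R.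
Proof.
move=> ii'; rewrite (bigD1 i)//= eqxx expr1 (bigD1 i') 1?eq_sym//= eqxx orbT.
rewrite big1 => [|j /andP[/negbTE -> /negbTE ->]]; last by rewrite expr0.
by rewrite mulr1 expr1 mulrNN mulr1.
Qed.

Lemma tperm_lt (k : nat) (i j : 'I_n) : (i < k)%N -> (j < k)%N ->
  forall l, (tperm i j l < k)%N = (l < k)%N.
Proof. by move=> ik jk l; case: tpermP => [->|->|//]; rewrite ik jk. Qed.

(** Among the points of [K] with the same value of the functional [init_ind k],
    take the one of least norm. It is unique by convexity, hence fixed by every
    rotation of the cross-polytope fixing [init_ind k]. In dimension at least 3
    there are enough of them: the sign of a reflection can always be corrected
    by another reflection that does not interfere. *)
Lemma average_init_ind (k : nat) x : (0 < k <= n)%N -> K x ->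
  K ((dotv x (init_ind k) / k%:R) *: init_ind k).
Proof.
move=> /andP[k0 kn] Kx.
pose A := K `&` [set y | dotv y (init_ind k) = dotv x (init_ind k)].
have cA : compact A.
  apply: compact_closedI => //.
  rewrite (_ : [set y | _] = (fun y =>
    dotv y (init_ind k)) @^-1` [set dotv x (init_ind k)])//.
  apply: closed_comp; first by move=> y _; exact: continuous_dotvl.
  exact: closed_eq.
have [|y Ay ymin] := EVT_min_rV (f :=
  fun y => dotv y y) (ex_intro _ x (conj Kx erefl)) cA.
  by apply: continuous_subspaceT => y; exact: continuous_dotvv.
have [Ky yx] := set_mem Ay.
have fixy s e : signed_perm_det s e = 1 :> R ->
    (forall i : 'I_n, (s i < k)%N = (i < k)%N) ->
    (forall i : 'I_n, (i < k)%N -> e i = false) ->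
      forall i, y 0 i = (-1) ^+ e i * y 0 (s i).
  move=> se1 sk ek; set z := signed_perm s e y.
  suff yz : y = z by move=> i; rewrite {1}yz mxE.
  (* Midpoint of [y] and its image: by the parallelogram identity it would be
     strictly shorter than [y] if they differed. *)
  pose h : 'rV[R]_n := (2^-1 : R) *: y + (1 - 2^-1) *: z.
  have Ah : h \in A.
    apply/mem_set; split.
      apply: convex_seg => //; first exact: K_inv.
      by rewrite invr_ge0 ler0n invf_le1 ?ler1n.
    rewrite /= dotvDl !dotvZl dotv_signed_perm_ind// yx; lra.
  have := ymin h Ah; have zz : dotv z z = dotv y y by exact:
    dotv_signed_perm_self.
  have := @dotvv_gt0 _ _ (y - z).
  rewrite /h !(dotvDl, dotvDr, dotvZl, dotvZr, dotvNl, dotvNr) (dotvC z y) zz.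
  have [/eqP|yz0] := eqVneq (y - z) 0; first by rewrite subr_eq0 => /eqP.
  by move=> /(_ isT) h1 h2; exfalso; lra.
have lt1n : (1 < n)%N by exact: ltnW.
pose o0 := Ordinal (ltnW lt1n); pose o1 := Ordinal lt1n;
  pose o2 := Ordinal n_gt2.
have third (i j : 'I_n) : exists l : 'I_n, (l != i) && (l != j).
  have [/andP[a b]|H0] := boolP ((o0 != i) && (o0 != j)); first by exists o0;
    rewrite a b.
  have [/andP[a b]|H1] := boolP ((o1 != i) && (o1 != j)); first by exists o1;
    rewrite a b.
  exists o2; move: H0 H1; rewrite !negb_and !negbK -!val_eqE /=.
  by case: (val i) (val j) => [|[|i']] [|[|j']].
have y0 (i : 'I_n) : (k <= i)%N -> y 0 i = 0.
  move=> ki; suff : y 0 i = - y 0 i by lra.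
  have [k1|k1] := ltnP 1 k.
    have ek (j : 'I_n) : (j < k)%N -> (j == i) = false.
      by move=> jk; apply/negbTE; rewrite -val_eqE /= neq_ltn (leq_trans jk ki).
    have sk : forall l : 'I_n, (tperm o0 o1 l < k)%N = (l < k)%N.
      by apply: tperm_lt => //=; exact: ltnW.
    have se1 : signed_perm_det (tperm o0 o1) (fun j => j == i) = 1 :> R.
      by rewrite /signed_perm_det odd_tperm prod_sign1 mulrNN mulr1.
    rewrite [LHS](fixy _ _ se1 sk ek) eqxx expr1 mulN1r tpermD//.
      by rewrite -val_eqE /= neq_ltn (leq_trans _ ki).
    by rewrite -val_eqE /= neq_ltn (leq_trans k1 ki).
  have {}k1 : k = 1%N by apply/eqP; rewrite eqn_leq k1.
  have i0 : o0 != i by rewrite -val_eqE /= neq_ltn (leq_trans _ ki) ?k1.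
  have [j /andP[ji j0]] := third i o0.
  have se1 : signed_perm_det 1%g (fun l => (l == i) || (l == j)) = 1 :> R.
    by rewrite /signed_perm_det odd_perm1 prod_sign2 1?eq_sym// mul1r.
  have sk : forall l : 'I_n, ((1%g : 'S_n) l < k)%N = (l < k)%N by move=> l;
    rewrite perm1.
  have ek (l : 'I_n) : (l < k)%N -> (l == i) || (l == j) = false.
    rewrite k1 ltnS leqn0 => l0; have -> : l = o0 by apply/val_inj/eqP.
    by rewrite (negbTE i0) eq_sym (negbTE j0).
  by rewrite [LHS](fixy _ _ se1 sk ek) eqxx expr1 mulN1r perm1.
have yeq (i j : 'I_n) : (i < k)%N -> (j < k)%N -> y 0 i = y 0 j.
  move=> ik jk; have [->//|ij] := eqVneq i j.
  have [kn'|kn'] := ltnP k n.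
    have n1 : (n.-1 < n)%N by rewrite prednK// (ltn_trans _ lt1n).
    have ek (l : 'I_n) : (l < k)%N -> (l == Ordinal n1) = false.
      move=> lk; apply/negbTE; rewrite -val_eqE /= neq_ltn.
      by rewrite (leq_trans lk)// -ltnS prednK// (ltn_trans _ lt1n).
    have se1 : signed_perm_det (tperm i j) (fun l => l == Ordinal n1) = 1 :> R.
      by rewrite /signed_perm_det odd_tperm ij prod_sign1 mulrNN mulr1.
    by rewrite [LHS](fixy _ _ se1 (tperm_lt ik jk) ek) ek// mul1r tpermL.
  have kE : k = n by apply/eqP; rewrite eqn_leq kn.
  have [l /andP[li lj]] := third i j.
  have se1 : signed_perm_det (tperm i j * tperm i l)%g (fun=> false) = 1 :> R.
    by rewrite /signed_perm_det odd_permM !odd_tperm ij [i == l]eq_sym li /=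
      big1// mul1r.
  have sk (h : 'I_n) : ((tperm i j * tperm i l)%g h < k)%N = (h < k)%N.
    by rewrite kE !ltn_ord.
  rewrite [LHS](fixy _ _ se1 sk) ?mul1r ?permM ?tpermL ?tpermD// eq_sym//.
suff <- : y = (dotv x (init_ind k) / k%:R) *: init_ind k by [].
have yE i : y 0 i = y 0 o0 * (i < k)%:R.
  have [ik|ik] := ltnP i k; first by rewrite mulr1; exact: yeq.
  by rewrite mulr0 y0.
have k0R : k%:R != 0 :> R by rewrite pnatr_eq0 -lt0n.
have dk : dotv x (init_ind k) = y 0 o0 * k%:R.
  rewrite -yx dotv_init_ind (eq_bigr (fun=> y 0 o0)); last first.
    by move=> i ik; rewrite yE ik mulr1.
  by rewrite -(big_ord_widen n (fun=> y 0 o0) kn) sumr_const card_ord mulr_natr.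
apply/rowP => i; rewrite yE dk mulfK// !mxE.
by [].
Qed.

End Averaging.

(** * Dual pairs of points with the symmetry of the cross-polytope *)

(** Move an interior point, or its opposite, slightly in the direction [u]. *)
Lemma body_dotv_gt0 (R : realType) n (K : set 'rV[R]_n) u :
  (forall x, K x -> K (- x)) -> K° !=set0 -> u != 0 ->
  exists2 x, K x & 0 < dotv x u.
Proof.
move=> Ksym [z Kz] u0; have uu := dotvv_gt0 u0.
have [zu|zu] := ltP (dotv z u) 0.
  exists (- z); first by apply: Ksym; exact: interior_subset.
  by rewrite dotvNl oppr_gt0.
have cF : {for (0 : R), continuous (fun t : R => z + t *: u)}.
  apply: continuousD; first exact: cst_continuous.
  exact: scalel_continuous.
have : \forall t \near (0 : R), K (z + t *: u).
  by apply: cF; rewrite scale0r addr0.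
move=> /nbhs_ballP[e /= e0 He]; exists (z + (e / 2) *: u).
  apply: He; rewrite /ball /= sub0r normrN gtr0_norm ?divr_gt0//.
  by rewrite ltr_pdivrMr// ltr_pMr// ltr1n.
by rewrite dotvDl dotvZl ltr_wpDl// mulr_gt0// divr_gt0.
Qed.

(** An improper signed permutation acts on [init_ind] like a proper one: compose
    it with a transposition of two equal coordinates, or change the sign of a
    zero one. *)
Lemma so_invariant_signed_perm_ind (R : realType) n (Q : set 'rV[R]_n)
    (r : R) (k : 'I_n) s e :
  (1 < n)%N -> so_invariant Q -> Q (r *: init_ind k.+1) ->
    Q (r *: signed_perm s e (init_ind k.+1)).
Proof.
move=> n1 QI Qr.
have spZ s' e' : r *: signed_perm s' e' (init_ind k.+1) = signed_perm s' e' (r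
  *: init_ind k.+1).
  by apply/rowP => i; rewrite !mxE mulrCA.
have Hpar (s' : 'S_n) e' : signed_perm_det s' e' = 1 :> R \/ signed_perm_det s'
  e' = -1 :> R.
  rewrite /signed_perm_det.
  have : exists b : bool, \prod_i (-1) ^+ (e' i) = (-1) ^+ b :> R.
    elim/big_rec : _ => [|i x _ [b ->]]; first by exists false.
    by exists (e' i (+) b); rewrite signr_addb.
  move=> [b ->]; rewrite -signr_addb; case: (_ (+) _); [by right|by left].
have [se1|se1] := Hpar s e; first by rewrite spZ; exact: QI.
have [k1|k1] := ltnP 0 k.
  pose o0 : 'I_n := Ordinal (ltnW n1); pose o1 : 'I_n := Ordinal n1.
  suff -> : signed_perm s e (init_ind k.+1) = signed_perm (s * tperm o0 o1)%g e
    (init_ind k.+1) :> 'rV[R]_n.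
    rewrite spZ; apply: QI => //; move: se1;
      rewrite /signed_perm_det odd_permM odd_tperm.
    by rewrite signr_addb expr1 mulrN1 mulNr => ->; rewrite opprK.
  by apply/rowP => i; rewrite !mxE permM tperm_lt.
have n1' : (n.-1 < n)%N by rewrite prednK// ltnW.
pose i0 := (s^-1)%g (Ordinal n1').
suff -> : signed_perm s e (init_ind k.+1) = signed_perm s (fun j =>
  e j (+) (j == i0)) (init_ind k.+1) :> 'rV[R]_n.
  rewrite spZ; apply: QI => //; move: se1; rewrite /signed_perm_det.
  under [in X in _ -> X]eq_bigr do rewrite signr_addb.
  by rewrite big_split /= prod_sign1 mulrN1 mulrN => ->; rewrite opprK.
apply/rowP => i; rewrite !mxE; have [->|_] := eqVneq i i0;
  last by rewrite addbF.
rewrite permKV /= [(n.-1 < _)%N](_ : _ = false) ?mulr0//.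
by apply/negbTE; rewrite -leqNgt (leq_ltn_trans k1)// -ltnS prednK// ltnW.
Qed.

Section Corners.
Context {R : realType} {n : nat} (n_gt2 : (2 < n)%N).
Variable K : set 'rV[R]_n.
Hypotheses (K_compact : compact K) (K_convex : convex K) (K_inv : so_invariant
  K).
Hypotheses (K_sym : forall x, K x -> K (- x)) (K_int : K° !=set0).

(** [s k] is the maximum on [K] of the mean of the first [k.+1] coordinates: the
    maximality puts the second point in the polar body, the averaging puts the
    first one in [K]. *)
Lemma exists_polar_corners : exists s : 'I_n -> R, [/\ forall k, 0 < s k,
  forall (k : 'I_n) sg e, K (s k *: signed_perm sg e (init_ind k.+1)) &
  forall (k : 'I_n) sg e, polar_body K ((k.+1%:R * s k)^-1 *: signed_perm sg e
    (init_ind k.+1))].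
Proof.
suff /choice[s Hs] : forall k : 'I_n, exists r : R, [/\ 0 < r,
  K (r *: init_ind k.+1) &
    polar_body K ((k.+1%:R * r)^-1 *: init_ind k.+1)].
  have n1 : (1 < n)%N by exact: ltnW.
  exists s; split=> [k|k sg e|k sg e]; have [? ? ?] := Hs k => //.
    exact: so_invariant_signed_perm_ind.
  by apply: (@so_invariant_signed_perm_ind _ _ (polar_body K)) => //;
    exact: so_invariant_polar.
move=> k; have k0R : k.+1%:R != 0 :> R by rewrite pnatr_eq0.
have i0 : init_ind k.+1 != 0 :> 'rV[R]_n.
  by apply/eqP => /rowP/(_ k); rewrite !mxE ltnSn => /eqP; rewrite oner_eq0.
have [x Kx x0] := body_dotv_gt0 K_sym K_int i0.
have [|z Kz zmax] := EVT_max_rV (f :=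
  fun y => dotv y (init_ind k.+1)) (ex_intro _ x Kx) K_compact.
  by apply: continuous_subspaceT => y; exact: continuous_dotvl.
have {}Kz := set_mem Kz.
have z0 : 0 < dotv z (init_ind k.+1) by exact: lt_le_trans x0 (zmax x (mem_set
  Kx)).
exists (dotv z (init_ind k.+1) / k.+1%:R); split; first by rewrite divr_gt0.
  by apply: (average_init_ind n_gt2 K_compact K_convex K_inv) => //=.
move=> y Ky; rewrite dotvZr mulrC ler_pdivrMr;
  last by rewrite mulr_gt0 ?divr_gt0.
by rewrite mul1r mulrC divfK//; exact: (zmax y (mem_set Ky)).
Qed.

End Corners.

(** * Lattice points in simplices *)

Lemma expr_sub_le (R : realType) (x y : R) n : 0 <= y -> y <= x ->
  x ^+ n.+1 - y ^+ n.+1 <= n.+1%:R * x ^+ n * (x - y).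
Proof.
move=> y0 yx; rewrite subrXX mulrC ler_wpM2r ?subr_ge0//.
have -> : n.+1%:R * x ^+ n = \sum_(i < n.+1) x ^+ n :> R.
  by rewrite sumr_const card_ord mulr_natl.
apply: ler_sum => i _ /=.
have x0 := le_trans y0 yx.
rewrite -[in leRHS](@subnK i n) ?leq_ord// exprD; apply: ler_wpM2l;
  first exact: exprn_ge0.
by apply: lerXn2r; rewrite ?nnegrE.
Qed.

(** Left endpoint sum of the decreasing function [t |-> (th - t / a) ^ n] over
    [t <= th * a], compared with its integral. *)
Lemma riemann_sum_ge (R : realType) n M (a th : R) :
  0 <= th -> 0 < a -> th * a <= M%:R ->
  th ^+ n.+1 * a / n.+1%:R <=
  \sum_(j < M | j%:R / a <= th) (th - j%:R / a) ^+ n.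
Proof.
move=> th0 a0 aM; have aN0 : a != 0 by rewrite gt_eqF.
(* [g] is a primitive, up to a factor, and its increments telescope. *)
pose g (j : nat) : R := Num.max 0 (th - j%:R / a) ^+ n.+1.
have gstep j : g j - g j.+1 <= if j%:R / a <= th
    then n.+1%:R / a * (th - j%:R / a) ^+ n else 0.
  have dj : j.+1%:R / a = j%:R / a + a^-1 by rewrite -natr1 mulrDl mul1r.
  have aV : 0 < a^-1 by rewrite invr_gt0.
  rewrite /g dj; move: (j%:R / a) => t.
  case: ifPn => [tth|]; last first.
    rewrite -ltNge => tth.
    by rewrite !max_l ?subrr//; lra.
  have x0 : 0 <= th - t by rewrite subr_ge0.
  rewrite (max_r x0); set y := Num.max _ _.
  have y0 : 0 <= y by rewrite le_max lexx.
  have yx : y <= th - t by rewrite ge_max x0 /=; lra.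
  have yd : th - t - y <= a^-1.
    have : th - (t + a^-1) <= y by rewrite le_max lexx orbT.
    lra.
  apply: le_trans (expr_sub_le n y0 yx) _.
  rewrite mulrAC ler_wpM2r ?exprn_ge0//; first by rewrite ler_wpM2l.
have tele : \sum_(j < M) (g j - g j.+1) = th ^+ n.+1.
  rewrite -(big_mkord xpredT (fun j => g j - g j.+1)).
  have -> : \sum_(0 <= j < M) (g j - g j.+1) = - \sum_(0 <= j < M) (g j.+1 - g
    j).
    by rewrite -sumrN; apply: eq_bigr => j _; rewrite opprB.
  rewrite telescope_sumr// opprB /g mul0r subr0 max_r//.
  rewrite [X in _ - X ^+ _]max_l ?expr0n ?subr0//.
  by rewrite subr_le0 ler_pdivlMr.
rewrite -tele ler_pdivrMr ?ltr0n//.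
have : \sum_(j < M) (g j - g j.+1) <= n.+1%:R / a * \sum_(j < M | j%:R / a <=
  th) (th - j%:R / a) ^+ n.
  by rewrite mulr_sumr [leRHS]big_mkcond; apply: ler_sum => j _; exact: gstep.
move=> H; rewrite -(ler_pM2r a0) in H; apply: (le_trans H).
by rewrite mulrAC divfK// mulrC.
Qed.

(** Integer points of the simplex with vertices [0] and [th * a k] on the axes.
    The cut-off [M] only serves finiteness. *)
Definition simplex_points (R : realType) n M (a : 'I_n ->
  R) (th : R) : {set {ffun 'I_n -> 'I_M}} :=
  [set z : {ffun 'I_n -> 'I_M} | \sum_k (z k)%:R / a k <= th].

(** The unit cubes with these points as lowest corners cover the simplex, whose
    volume is the left-hand side. The induction slices along the first axis. *)
Lemma card_simplex_points_ge (R : realType) n M (a : 'I_n -> R) (th : R) :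
  0 <= th -> (forall k, 0 < a k) -> (forall k, th * a k <= M%:R) ->
  th ^+ n * \prod_k a k / n`!%:R <= #|simplex_points M a th|%:R.
Proof.
elim: n a th => [|n IH] a th th0 a0 aM.
  rewrite big_ord0 expr0 fact0 !mulr1 divr1 ler1n.
  have f : 'I_0 -> 'I_M by case.
  by apply/card_gt0P; exists (finfun f); rewrite inE big_ord0.
pose a' k := a (lift ord0 k).
pose cons (j : 'I_M) (z : {ffun 'I_n -> 'I_M}) : {ffun 'I_n.+1 -> 'I_M} :=
  [ffun i => oapp z j (unlift ord0 i)].
have cons0 j z : cons j z ord0 = j by rewrite ffunE unlift_none.
have consS j z k : cons j z (lift ord0 k) = z k by rewrite ffunE liftK.
have cons_inj j : injective (cons j).
  by move=> z z' /ffunP zz; apply/ffunP => k; rewrite -(consS j z) zz consS.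
have slice (j : 'I_M) : j%:R / a ord0 <= th ->
    (#|simplex_points M a' (th - j%:R / a ord0)| <=
     \sum_(z in simplex_points M a th | z ord0 == j) 1)%N.
  move=> jth; rewrite -(card_imset _ (@cons_inj j)) sum1dep_card
    subset_leq_card//.
  apply/fintype.subsetP => _ /imsetP[z + ->];
    rewrite !inE cons0 eqxx andbT => H.
  rewrite big_ord_recl cons0 -lerBrDl.
  by under eq_bigr do rewrite consS.
rewrite -[X in _ <= X%:R]sum1_card (partition_big (fun z : {ffun 'I_n.+1 ->
  'I_M} => z ord0) xpredT)//=.
apply: (@le_trans _ _ (\sum_(j < M | j%:R / a ord0 <= th)
    ((th - j%:R / a ord0) ^+ n * \prod_k a' k / n`!%:R))); last first.
  rewrite natr_sum [leLHS]big_mkcond /=; apply: ler_sum => j _;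
    case: ifPn => // jth.
  apply: (@le_trans _ _ #|simplex_points M a' (th - j%:R / a ord0)|%:R);
    last first.
    by rewrite ler_nat; exact: slice.
  apply: IH => [|k|k]; [by rewrite subr_ge0|exact: a0|].
  apply: le_trans (aM (lift ord0 k)); rewrite ler_wpM2r ?(ltW (a0 _))//.
  by rewrite gerBl divr_ge0// ltW.
rewrite -!mulr_suml big_ord_recl factS natrM invfM.
have := riemann_sum_ge n th0 (a0 ord0) (aM ord0).
set S := \sum_(j < M | _) _ => HS.
have P0 : 0 <= \prod_k a' k / n`!%:R.
  by apply: divr_ge0 => //; apply: prodr_ge0 => k _; exact: ltW (a0 _).
rewrite -[leRHS]mulrA; apply: le_trans (ler_wpM2r P0 HS).
by rewrite le_eqVlt; apply/orP; left; apply/eqP; rewrite /a'; ring.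
Qed.

Section ChamberPoints.
Context {n M : nat}.
Implicit Types (z : {ffun 'I_n -> 'I_M}) (s : 'S_n) (e : {ffun 'I_n -> bool}).

(** Coordinates of a point of the open Weyl chamber from its successive
    differences. *)
Definition tail_sum z (m : nat) : nat := \sum_(k < n) (z k).+1 * (m <= k).

Lemma tail_sumS z (j : 'I_n) : tail_sum z j = ((z j).+1 + tail_sum z j.+1)%N.
Proof.
rewrite /tail_sum (bigD1 j)//= leqnn muln1 [in RHS](bigD1 j)//= ltnn muln0
  add0n.
congr addn; apply: eq_bigr => k kj; congr (_ * _)%N; congr nat_of_bool.
by rewrite [RHS]ltn_neqAle [j == k :> nat]eq_sym (inj_eq val_inj) kj.
Qed.

Lemma tail_sum_le z (m m' : nat) : (m <= m')%N ->
  (tail_sum z m' <= tail_sum z m)%N.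
Proof.
move=> mm'; apply: leq_sum => k _; rewrite leq_mul2l; apply/orP; right.
by have [m'k|//] := leqP m' k; rewrite (leq_trans mm' m'k).
Qed.

Lemma tail_sum_lt z (i j : 'I_n) : (tail_sum z j < tail_sum z i)%N = (i < j)%N.
Proof.
have H (a b : 'I_n) : (a < b)%N -> (tail_sum z b < tail_sum z a)%N.
  move=> ab; rewrite (tail_sumS z a); apply: (leq_ltn_trans (tail_sum_le z ab)).
  by rewrite -[ltnLHS]add0n ltn_add2r.
case: (ltngtP i j) => [/H//|/H ji|/val_inj ->]; last by rewrite ltnn.
by apply/negbTE; rewrite -leqNgt ltnW.
Qed.

Lemma tail_sum_gt0 z (i : 'I_n) : (0 < tail_sum z i)%N.
Proof. by rewrite tail_sumS. Qed.

Lemma perm_mono_id s : (forall i j : 'I_n, (i < j)%N -> (s i < s j)%N) ->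
  s = 1%g.
Proof.
have ge (t : 'S_n) : (forall i j : 'I_n, (i < j)%N -> (t i < t j)%N) ->
    forall i : 'I_n, (i <= t i)%N.
  move=> tmono [m]; elim: m => [//|m IH] mn /=.
  have mn' := ltnW mn; apply: (leq_ltn_trans (IH mn')); exact: tmono.
move=> smono; have smono' (i j : 'I_n) : (i < j)%N ->
  ((s^-1)%g i < (s^-1)%g j)%N.
  move=> ij; rewrite ltnNge; apply/negP;
    rewrite leq_eqVlt => /orP[/eqP/val_inj/perm_inj|/smono].
    by move=> ji; rewrite ji ltnn in ij.
  by rewrite !permKV ltnNge ltnW.
apply/permP => i; rewrite perm1; apply/val_inj/eqP; rewrite eqn_leq ge// andbT.
by have := ge _ smono' (s i); rewrite permK.
Qed.

(** A permutation and signs choose a chamber, and [t.2], increased by one, are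
    coordinates in a basis of the integer lattice made of the edges of this
    chamber. *)
Definition chamber_point (t : 'S_n * {ffun 'I_n -> bool} * {ffun 'I_n ->
  'I_M}) : 'rV[int]_n :=
  \row_i ((-1) ^+ t.1.2 i * (tail_sum t.2 (t.1.1 i))%:Z).

(** Absolute values of the coordinates are positive and strictly ordered, so
    they determine the signs and the permutation, then the differences. *)
Lemma chamber_point_inj : injective chamber_point.
Proof.
move=> [[s e] z] [[s' e'] z'] /rowP E.
have EY i : tail_sum z (s i) = tail_sum z' (s' i).
  have := E i; rewrite !mxE /= => /(congr1 (fun x : int => `|x|%N)).
  by rewrite !abszMsign.
have {E} Ee : e = e'.
  apply/ffunP => i; have := E i; rewrite !mxE /= EY.
  have := tail_sum_gt0 z' (s' i); move: (tail_sum _ _) => y y0.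
  by case: (e i) (e' i) => [] [] //; rewrite ?expr0 ?expr1; lia.
have Es : s = s'.
  suff : (s^-1 * s')%g = 1%g by move/(canRL (mulKVg _)); rewrite mulg1.
  apply: perm_mono_id => i j; rewrite -(tail_sum_lt z) -(tail_sum_lt z') !permM.
  by rewrite -!EY !permKV.
subst e' s'; congr (_, _, _).
have EYm m : tail_sum z m = tail_sum z' m.
  have [mn|nm] := ltnP m n.
    by have := EY ((s^-1)%g (Ordinal mn)); rewrite permKV.
  by rewrite /tail_sum !big1// => k _;
    rewrite leqNgt (leq_trans (ltn_ord k) nm) muln0.
apply/ffunP => j; apply/val_inj; have := EYm j; rewrite !tail_sumS EYm.
by move=> /addIn [].
Qed.

End ChamberPoints.

(** In each chamber, the simplex with vertices [0] and the [s k] corners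
    contains the points whose coordinates [z] along the edges satisfy [\sum_k
    eps * (z k + 1) / s k <= 1]; requiring positive coordinates keeps the
    chambers disjoint and only lowers the bound to [1 - \sum_k eps / s k]. *)
Lemma lattice_points_corners (R : realType) n (Q : set 'rV[R]_n)
    (s : 'I_n -> R) (eps : R) :
  convex Q -> Q 0 -> (forall k, 0 < s k) ->
  (forall (k : 'I_n) sg e, Q (s k *: signed_perm sg e (init_ind k.+1))) ->
  0 < eps -> 0 <= 1 - \sum_k eps / s k ->
  exists (T : finType) (f : T -> 'rV[int]_n), [/\ injective f,
    forall t, Q (lattice_point eps (f t)) &
    2 ^+ n * \prod_k s k * (1 - \sum_k eps / s k) ^+ n <= #|T|%:R * eps ^+ n].
Proof.
move=> cQ Q0 s0 Qs e0; set th := 1 - _ => th0.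
pose a k := s k / eps; have a0 k : 0 < a k by rewrite divr_gt0.
pose M := (\max_k Num.bound (th * a k))%N.
have aM k : th * a k <= M%:R.
  apply: ltW; apply: lt_le_trans (archi_boundP _) _;
    first by rewrite mulr_ge0// ltW.
  by rewrite ler_nat; apply: (leq_bigmax k).
pose Z := simplex_points M a th.
exists ('S_n * {ffun 'I_n -> bool} * {z : {ffun 'I_n -> 'I_M} | z \in Z})%type.
exists (fun t => chamber_point (t.1, val t.2)); split.
- by move=> [t z] [t' z'] /chamber_point_inj[/= -> /val_inj ->].
- move=> [[sg e] [z /= zZ]].
  have -> : lattice_point eps (chamber_point (sg, e, z)) =
      \sum_k (eps * (z k).+1%:R / s k) *: (s k *: signed_perm sg e (init_ind
        k.+1)) :> 'rV[R]_n.
    apply/rowP => i; rewrite !mxE summxE /= rmorphM /= rmorph_sign mulrCA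
      -pmulrn natr_sum.
    rewrite !mulr_sumr; apply: eq_bigr => k _; rewrite !mxE ltnS natrM.
    by field; rewrite gt_eqF.
  apply: convex_sum => // [k|].
    by rewrite divr_ge0 ?(ltW (s0 _))// mulr_ge0 ?ltW.
  move: zZ; rewrite inE /th lerBrDr -big_split /=; apply: le_trans.
  apply: ler_sum => k _; rewrite -natr1 /a le_eqVlt; apply/orP; left; apply/eqP.
  by field; rewrite !gt_eqF.
- have := card_simplex_points_ge th0 a0 aM; rewrite -/Z.
  have -> : \prod_k a k = \prod_k s k / eps ^+ n.
    by rewrite big_split /= prodr_const card_ord exprVn.
  rewrite !card_prod card_Sn card_ffun card_bool card_ord card_sig !natrM natrX.
  rewrite (_ : #|[pred x | x \in Z]| = #|Z|); last by apply: eq_card => x;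
    rewrite inE.
  move: (\prod_k s k) #|Z|%:R => P N H.
  have f0 : n`!%:R != 0 :> R by rewrite pnatr_eq0 -lt0n fact_gt0.
  have en0 : 0 < eps ^+ n by rewrite exprn_gt0.
  have -> : n`!%:R * 2 ^+ n * N * eps ^+ n = N * (n`!%:R * 2 ^+ n * eps ^+ n) by
    ring.
  have pos : 0 <= n`!%:R * 2 ^+ n * eps ^+ n by rewrite !mulr_ge0// ?exprn_ge0//
    ltW.
  apply: le_trans (ler_wpM2r pos H).
  by rewrite le_eqVlt; apply/orP; left; apply/eqP; field; rewrite f0 gt_eqF.
Qed.

(** * Lower bounds for volumes of Lagrangian products *)

(** [Q] has inner Jordan content at least [V], with a linear rate in the mesh
    [eps]. A finite type with an injection counts lattice points without naming
    the set of all of them, so that subsets and products are immediate. *)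
Definition inner_volume_ge {R : realType} {n : nat} (Q : set 'rV[R]_n) (V : R)
  :=
  exists C : R, forall eps, 0 < eps -> exists (T : finType) (f : T ->
    'rV[int]_n),
    [/\ injective f, forall t, Q (lattice_point eps (f t)) &
        V - C * eps <= #|T|%:R * eps ^+ n].

Lemma compact_lagrangian_product (R : realType) n (K L : set 'rV[R]_n) :
  compact K -> compact L -> compact (lagrangian_product K L).
Proof.
move=> cK cL; pose f (p : 'rV[R]_n * 'rV[R]_n) : 'rV[R]_(n + n) :=
  row_mx p.1 p.2.
have -> : lagrangian_product K L = f @` (K `*` L).
  apply/seteqP; split=> [z [Kz Lz]|_ [[x y] [/= Kx Ly] <-]].
    by exists (lsubmx z, rsubmx z) => //; rewrite /f /= hsubmxK.
  by split; rewrite /= ?row_mxKl ?row_mxKr.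
apply: continuous_compact; last exact: compact_setX.
apply: continuous_subspaceT => p; apply: continuous_rV => j.
rewrite /f; case: (splitP j) => k jk.
  have -> : j = lshift n k by apply/val_inj.
  rewrite (_ : (fun _ => _) = (fun x : 'rV[R]_n => x 0 k) \o fst); last first.
    by apply/funext => y; rewrite row_mxEl.
  by apply: continuous_comp; [exact: cvg_fst|exact: coord_continuous].
have -> : j = rshift n k by apply/val_inj.
rewrite (_ : (fun _ => _) = (fun x : 'rV[R]_n => x 0 k) \o snd); last first.
  by apply/funext => y; rewrite row_mxEr.
by apply: continuous_comp; [exact: cvg_snd|exact: coord_continuous].
Qed.

(** Pairs of lattice points are lattice points of the product. *)
Lemma volume_lagrangian_product_ge (R : realType) n (K L : set 'rV[R]_n) (V W :
  R) :
  compact K -> compact L -> 0 <= V -> 0 <= W ->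
  inner_volume_ge K V -> inner_volume_ge L W ->
  ((V * W)%:E <= volume (lagrangian_product K L))%E.
Proof.
move=> cK cL V0 W0 [C0 HK] [D0 HL].
pose C := Num.max 0 C0; pose D := Num.max 0 D0.
have C_ge0 : 0 <= C by rewrite le_max lexx.
have D_ge0 : 0 <= D by rewrite le_max lexx.
have C0C : C0 <= C by rewrite le_max lexx orbT.
have D0D : D0 <= D by rewrite le_max lexx orbT.
apply/lee_addgt0Pr => d d0.
have d2 : 0 < d / 2 by rewrite divr_gt0.
have [e0 e0_gt0 H] := volume_ge_lattice (compact_lagrangian_product cK cL) d2.
pose B := C * W + D * V.
have B0 : 0 <= B by rewrite addr_ge0// mulr_ge0.
pose eps := Num.min e0 (d / 2 / (B + 1)).
have eps0 : 0 < eps by rewrite lt_min e0_gt0 divr_gt0// ltr_wpDl.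
have epsB : eps * B <= d / 2.
  have : eps <= d / 2 / (B + 1) by rewrite ge_min lexx orbT.
  by rewrite ler_pdivlMr ?ltr_wpDl// mulrDr mulr1; lra.
have [T [f [finj fK Tge]]] := HK eps eps0.
have [T' [g [ginj gL T'ge]]] := HL eps eps0.
pose h (t : T * T') : 'rV[int]_(n + n) := row_mx (f t.1) (g t.2).
have hinj : injective h.
  by move=> [t t'] [s s'] /eq_row_mx[/finj /= -> /ginj /= ->].
have eps_e0 : 0 < eps <= e0 by rewrite eps0 ge_min lexx.
have {H} := H eps eps_e0 _ h hinj.
have hKL t : lagrangian_product K L (lattice_point eps (h t)).
  split.
    rewrite (_ : lsubmx _ = lattice_point eps (f t.1)); first exact: fK.
    by apply/rowP => i; rewrite !mxE (unsplitK (inl i)).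
  rewrite (_ : rsubmx _ = lattice_point eps (g t.2)); first exact: gL.
  by apply/rowP => i; rewrite !mxE (unsplitK (inr i)).
move=> /(_ hKL) H.
rewrite [d in X in (_ <= X)%E](splitr d) EFinD addeA.
apply: le_trans (leeD2r _ H); rewrite -EFinD lee_fin card_prod natrM exprD
  mulrACA.
have a0 : 0 <= #|T|%:R * eps ^+ n by rewrite mulr_ge0// exprn_ge0// ltW.
have b0 : 0 <= #|T'|%:R * eps ^+ n by rewrite mulr_ge0// exprn_ge0// ltW.
move: (#|T|%:R * _) (#|T'|%:R * _) a0 b0 Tge T'ge => a b a0 b0 aV bW.
have Va : V - C * eps <= a by apply: le_trans aV;
  rewrite lerD2l lerN2 ler_wpM2r// ltW.
have Wb : W - D * eps <= b by apply: le_trans bW;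
  rewrite lerD2l lerN2 ler_wpM2r// ltW.
suff : V * W <= a * b + eps * B by lra.
rewrite /B; have Ce : 0 <= C * eps by rewrite mulr_ge0// ltW.
have De : 0 <= D * eps by rewrite mulr_ge0// ltW.
have ab0 := mulr_ge0 a0 b0.
rewrite mulrDr; have -> : eps * (C * W) = (C * eps) * W by ring.
have -> : eps * (D * V) = (D * eps) * V by ring.
move: (C * eps) (D * eps) Ce De Va Wb => x y x0 y0 Va Wb.
have [Vx|xV] := ltP V x.
  have : V * W <= x * W by rewrite ler_wpM2r// ltW.
  by have := mulr_ge0 y0 V0; lra.
have [Wy|yW] := ltP W y.
  have : W * V <= y * V by rewrite ler_wpM2r// ltW.
  by have := mulr_ge0 x0 W0; lra.
have : (V - x) * (W - y) <= a * b by apply: ler_pM => //; rewrite subr_ge0.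
by have := mulr_ge0 x0 y0; lra.
Qed.

Lemma inner_volume_ge_corners (R : realType) n (Q : set 'rV[R]_n) (s : 'I_n ->
  R) :
  (0 < n)%N -> convex Q -> Q 0 -> (forall k, 0 < s k) ->
  (forall (k : 'I_n) sg e, Q (s k *: signed_perm sg e (init_ind k.+1))) ->
  inner_volume_ge Q (2 ^+ n * \prod_k s k).
Proof.
move=> n0 cQ Q0 s0 Qs; pose V : R := 2 ^+ n * \prod_k s k.
pose c : R := \sum_k (s k)^-1.
have V0 : 0 <= V by rewrite mulr_ge0 ?exprn_ge0// prodr_ge0// => k _;
  exact: ltW.
exists (n%:R * c * V) => eps e0.
have cE : \sum_k eps / s k = eps * c by rewrite mulr_sumr.
have [th0|th0] := leP 0 (1 - \sum_k eps / s k).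
  have [T [f [finj fQ Tge]]] := lattice_points_corners cQ Q0 s0 Qs e0 th0.
  exists T, f; split=> //; apply: le_trans Tge; rewrite -/V cE.
  rewrite [leRHS]mulrC; have -> : V - n%:R * c * V * eps = (1 - n%:R * (eps *
    c)) * V by ring.
  apply: ler_wpM2r => //; rewrite cE in th0; move: (eps * c) th0 => x x1 {cE}.
  elim: (n) => [|m IH]; first by rewrite expr0 mul0r subr0.
  rewrite exprS; apply: le_trans (ler_wpM2l x1 IH); rewrite -natr1.
  have := mulr_ge0 (ler0n R m) (sqr_ge0 x); lra.
exists 'I_0, (fun=> 0); split=> [[]//|[]//|].
rewrite card_ord mul0r -/V; have ->
  : V - n%:R * c * V * eps = (1 - n%:R * (eps * c)) * V by ring.
apply: mulr_le0_ge0 => //; rewrite -cE subr_le0.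
apply: le_trans (_ : 1 <= n%:R) _; first by rewrite ler1n.
by rewrite ler_peMr// ltW// -subr_lt0.
Qed.

(** * Fans of triangles in the plane *)

Definition vec2 {R : nmodType} (a b : R) : 'rV[R]_2 :=
  \row_i (if i == 0 then a else b).

Lemma vec2_0 (R : nmodType) (a b : R) : vec2 a b 0 0 = a.
Proof. by rewrite mxE. Qed.

Lemma vec2_1 (R : nmodType) (a b : R) : vec2 a b 0 1 = b.
Proof. by rewrite mxE. Qed.

Lemma vec2_eta (R : nmodType) (x : 'rV[R]_2) : x = vec2 (x 0 0) (x 0 1).
Proof.
apply/rowP => i; rewrite mxE; case: eqVneq => [->//|i0].
by congr (x 0 _); apply/val_inj; case: i i0 => [[|[|]]].
Qed.

Definition quarter_turn {R : zmodType} (x : 'rV[R]_2) : 'rV[R]_2 :=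
  vec2 (- x 0 1) (x 0 0).

Lemma quarter_turn_inj (R : zmodType) : injective (@quarter_turn R).
Proof.
move=> x y /rowP E; have := E 0; have := E 1;
  rewrite !vec2_0 !vec2_1 => E0 /oppr_inj E1.
by rewrite [x]vec2_eta [y]vec2_eta E0 E1.
Qed.

Lemma lattice_point_quarter_turn (R : realType) (eps : R) (p : 'rV[int]_2) :
  lattice_point eps (quarter_turn p) = quarter_turn (lattice_point eps p).
Proof.
apply/rowP => i; rewrite !mxE; case: eqP => _ //.
by rewrite mulrNz mulrN.
Qed.

Lemma so_invariant_quarter_turn (R : realType) (Q : set 'rV[R]_2) x :
  so_invariant Q -> Q x -> Q (quarter_turn x).
Proof.
move=> QI Qx; have -> : quarter_turn x = signed_perm (tperm 0 1) (fun i =>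
  i == 0) x.
  apply/rowP => i; rewrite !mxE; case: eqVneq => [->|i0].
    by rewrite tpermL expr1 mulN1r.
  have -> : i = 1 by apply/val_inj; case: i i0 => [[|[|]]].
  by rewrite tpermR expr0 mul1r.
apply: QI => //; rewrite /signed_perm_det odd_tperm /= prod_sign1 expr1.
by rewrite mulrNN mulr1.
Qed.

(** Points of the triangle with vertices 0, [(al, 0)] and [(be, h)], row by row:
    in row [j] they start just after the edge from 0 to [(be, h)], hence the
    floor. The triangle is half-open, so that triangles sharing an edge stay
    disjoint. The count is the one of a right triangle, because [be] only shears
    the rows. *)
Lemma triangle_points (R : realType) (al h be eps : R) : 0 < al -> 0 <= h ->
  0 < eps ->
  exists (T : finType) (g : T -> int * int), [/\ injective g,
   forall t, (0 < (g t).2) /\ exists l m : R, [/\ 0 < l, 0 < m & l + m <= 1] /\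
     eps * (g t).1%:~R = l * al + m * be /\ eps * (g t).2%:~R = m * h &
   al * h / 2 - (al + h) * eps <= #|T|%:R * eps ^+ 2].
Proof.
move=> al0 h0 e0; pose c : 'I_2 -> R :=
  fun k => if k == 0 then al / eps else h / eps.
have trivial_case : al * h / 2 - (al + h) * eps <= 0 ->
   exists (T : finType) (g : T -> int * int), [/\ injective g,
   forall t, (0 < (g t).2) /\ exists l m : R, [/\ 0 < l, 0 < m & l + m <= 1] /\
     eps * (g t).1%:~R = l * al + m * be /\ eps * (g t).2%:~R = m * h &
   al * h / 2 - (al + h) * eps <= #|T|%:R * eps ^+ 2].
  move=> H; exists 'I_0, (fun=> (0, 0)); split=> [[]//|[]//|].
  by rewrite card_ord mul0r.
have [h_gt0|] := ltP 0 h; last first.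
  move=> hle; have hE : h = 0 by apply/eqP; rewrite eq_le h0 hle.
  by apply: trivial_case; rewrite hE mulr0 mul0r addr0 sub0r oppr_le0 mulr_ge0//
    ltW.
pose th := 1 - eps / al - eps / h.
have [th0|th0] := leP 0 th; last first.
  apply: trivial_case.
  have : al * h < (al + h) * eps.
    have : th * (al * h) < 0 by rewrite pmulr_llt0// mulr_gt0.
    suff -> : th * (al * h) = al * h - (al + h) * eps by lra.
    by rewrite /th; field; rewrite !gt_eqF.
  have := mulr_ge0 (ltW al0) h0; lra.
have c0 k : 0 < c k by rewrite /c; case: ifP => _; rewrite divr_gt0.
pose M := (\max_k Num.bound (th * c k))%N.
have cM k : th * c k <= M%:R.
  apply: ltW; apply: lt_le_trans (archi_boundP _) _;
    first by rewrite mulr_ge0// ltW.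
  by rewrite ler_nat; apply: (leq_bigmax k).
pose Z := simplex_points M c th.
pose row (z : {ffun 'I_2 -> 'I_M}) : int := (z 1%R).+1%:Z.
pose fl (z : {ffun 'I_2 -> 'I_M}) : int := Num.floor (be / h * (row z)%:~R).
exists {z : {ffun 'I_2 -> 'I_M} | z \in Z},
  (fun z => (fl (val z) + (val z 0%R).+1%:Z, row (val z))); split.
- move=> [z zZ] [z' zZ'] /= [E0 E1]; apply/val_inj/ffunP => /= k; apply/val_inj.
  have k01 : k = 0 \/ k = 1.
    by case: k => [[|[|]]] // ?; [left|right]; apply/val_inj.
  have E : fl z = fl z' by rewrite /fl /row E1.
  rewrite E in E0; move/addrI: E0 => [E0].
  by case: k01 => ->.
- move=> [z /= zZ]; split; first by [].
  have f1 : (fl z)%:~R <= be / h * (row z)%:~R :> R by exact: floor_le.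
  have f2 : be / h * (row z)%:~R < (fl z)%:~R + 1 :> R.
    by have := floorD1_gt (be / h * (row z)%:~R); rewrite intrD.
  have r0 : 0 < (row z)%:~R :> R by rewrite ltr0z.
  pose i : R := (fl z + (z 0%R).+1%:Z)%:~R.
  have iE : i = (fl z)%:~R + (z 0%R)%:R + 1 by rewrite /i intrD -addrA natr1.
  exists (eps * (i - be / h * (row z)%:~R) / al), (eps * (row z)%:~R / h).
  split; last by split; field; rewrite gt_eqF// ?gt_eqF.
  split.
  + rewrite divr_gt0// mulr_gt0// subr_gt0 iE.
    have := ler0n R (z 0%R); lra.
  + by rewrite divr_gt0// mulr_gt0.
  move: zZ; rewrite inE !big_ord_recl big_ord0 addr0 /c /= /th.
  rewrite [lift _ _](_ : _ = 1); last by apply/val_inj.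
  rewrite !invfM !invrK.
  have : i - be / h * (row z)%:~R <= (z 0%R)%:R + 1 by rewrite iE; lra.
  have ea : 0 < eps / al by rewrite divr_gt0.
  move=> /(ler_wpM2l (ltW ea)).
  have -> : eps * (i - be / h * (row z)%:~R) / al = eps / al * (i - be / h *
    (row z)%:~R) by ring.
  rewrite -[(row z)%:~R]/((z 1%R).+1%:R) -natr1.
  move: (i - _) => I; move: ((z 0%R)%:R : R) ((z 1%R)%:R : R) => a b.
  have -> : eps * (b + 1) / h = b * (h^-1 * eps) + eps / h by ring.
  have -> : a * (al^-1 * eps) = a * (eps / al) by ring.
  lra.
- have := card_simplex_points_ge th0 c0 cM; rewrite -/Z.
  rewrite !big_ord_recl big_ord0 mulr1 /c /= card_sig.
  rewrite (_ : #|[pred x | x \in Z]| = #|Z|); last by apply: eq_card => x;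
    rewrite inE.
  have e2 : 0 <= eps ^+ 2 by rewrite exprn_ge0// ltW.
  move=> /(ler_wpM2r e2); apply: le_trans.
  have -> : th ^+ 2 * (al / eps * (h / eps)) / 2`!%:R * eps ^+ 2 = al * h / 2 *
    th ^+ 2.
    by rewrite (_ : 2`! = 2)//; field; rewrite gt_eqF.
  have B : 1 - 2 * (eps / al + eps / h) <= th ^+ 2.
    have := sqr_ge0 (eps / al + eps / h); rewrite /th; nra.
  have ah : 0 <= al * h / 2 by rewrite divr_ge0// mulr_ge0// ltW.
  apply: le_trans (ler_wpM2l ah B).
  rewrite le_eqVlt; apply/orP; left; apply/eqP; field; rewrite !gt_eqF//.
Qed.

Lemma convex_pair (R : realType) n (Q : set 'rV[R]_n) x y (l m : R) :
  convex Q -> Q 0 -> Q x -> Q y -> 0 <= l -> 0 <= m -> l + m <= 1 ->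
    Q (l *: x + m *: y).
Proof.
move=> cQ Q0 Qx Qy l0 m0 lm.
have := @convex_sum _ _ Q _ [:: true; false] (fun b => if b then l else m)
  (fun b => if b then x else y) cQ Q0.
rewrite !big_cons !big_nil !addr0; apply=> // -[]//.
Qed.

(** [D] stands for a fundamental domain of the quarter turns. *)
Lemma quarter_turn_fan (R : realType) (Q : set 'rV[R]_2) (eps : R) (D :
  'rV[int]_2 -> Prop)
    (T1 T2 : finType) (p1 : T1 -> 'rV[int]_2) (p2 : T2 -> 'rV[int]_2) :
  (forall x, Q x -> Q (quarter_turn x)) ->
  (forall p, D p -> [/\ ~ D (quarter_turn p),
    ~ D (quarter_turn (quarter_turn p)) & ~ D (quarter_turn (quarter_turn
      (quarter_turn p)))]) ->
  injective p1 -> injective p2 -> (forall t t', p1 t <> p2 t') ->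
  (forall t, D (p1 t) /\ Q (lattice_point eps (p1 t))) ->
  (forall t, D (p2 t) /\ Q (lattice_point eps (p2 t))) ->
  exists (T : finType) (f : T -> 'rV[int]_2), [/\ injective f,
    forall t, Q (lattice_point eps (f t)) & #|T| = (4 * (#|T1| + #|T2|))%N].
Proof.
move=> Qrot Drot i1 i2 i12 H1 H2.
pose p (t : T1 + T2) := match t with inl a => p1 a | inr b => p2 b end.
have pinj : injective p.
  move=> [a|a] [b|b] /= E; first by rewrite (i1 _ _ E).
  - by case: (i12 _ _ E).
  - by case: (i12 _ _ (esym E)).
  - by rewrite (i2 _ _ E).
have pD t : D (p t) /\ Q (lattice_point eps (p t)) by case: t => t;
  [exact: H1|exact: H2].
exists ('I_4 * (T1 + T2))%type,
  (fun t : 'I_4 * (T1 + T2) => iter (t.1 : 'I_4) quarter_turn (p t.2)); split.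
- have rot_iter_inj k : injective (iter k (@quarter_turn int)).
    by elim: k => [|k IH] x y //= /quarter_turn_inj /IH.
  have key (k l : nat) t t' : (k <= l)%N -> (l < 4)%N ->
    iter k quarter_turn (p t) = iter l quarter_turn (p t') -> k = l /\ t = t'.
    move=> kl l4; rewrite -[in RHS](subnKC kl) iterD => /rot_iter_inj E.
    have [D0 _] := pD t; have [D1 D2 D3] := Drot _ (pD t').1.
    have lk : (l - k < 4)%N by rewrite (leq_ltn_trans (leq_subr _ _)).
    have lk0 : (l - k)%N = 0%N.
      by move: lk E D0; case: (l - k)%N => [//|[|[|[|//]]]] _ /= -> //.
    split; first by apply/eqP; rewrite eqn_leq kl -subn_eq0 lk0.
    by apply: pinj; move: E; rewrite lk0.
  move=> [k t] [l t'] /= E; case: (leqP k l) => kl.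
    by have [/val_inj -> ->] := key _ _ _ _ kl (ltn_ord l) E.
  by have [/val_inj -> ->] := key _ _ _ _ (ltnW kl) (ltn_ord k) (esym E).
- move=> [k t] /=; elim: (nat_of_ord k) => [|m IH] /=; first exact: (pD t).2.
  by rewrite lattice_point_quarter_turn; exact: Qrot.
- by rewrite card_prod card_sum card_ord.
Qed.

Section Fans.
Context {R : realType} (Q : set 'rV[R]_2).
Hypotheses (Q_convex : convex Q) (Q0 : Q 0) (Q_rot : forall x, Q x ->
  Q (quarter_turn x)).

Lemma vec2_inj (i j i' j' : int) : vec2 i j = vec2 i' j' -> i = i' /\ j = j'.
Proof. by move=> /rowP E; have := E 0; have := E 1;
  rewrite !vec2_0 !vec2_1. Qed.

Lemma lattice_point_vec2 (eps : R) (i j : int) :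
  lattice_point eps (vec2 i j) = vec2 (eps * i%:~R) (eps * j%:~R).
Proof. by apply/rowP => k; rewrite !mxE; case: ifP. Qed.

(** The triangles are [0, (al, 0), w] and [0, w, (0, al)], in the open first
    quadrant, and their quarter turns. Both have a side along a coordinate axis.
    *)
Lemma fan_axis (al w1 w2 : R) : 0 < al -> 0 <= w1 -> 0 <= w2 ->
  Q (vec2 al 0) -> Q (vec2 w1 w2) -> inner_volume_ge Q (2 * al * (w1 + w2)).
Proof.
move=> al0 w10 w20 Qa Qw.
have Qa' : Q (vec2 0 al).
  by have := Q_rot Qa; rewrite /quarter_turn vec2_0 vec2_1 oppr0.
exists (4 * ((al + w2) + (al + w1))) => eps e0.
have [T1 [g1 [i1 H1 c1]]] := triangle_points w1 al0 w20 e0.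
have [T2 [g2 [i2 H2 c2]]] := triangle_points w2 al0 w10 e0.
have [||||||T [f [finj fQ fc]]] :=
  @quarter_turn_fan R Q eps (fun p => 0 < p 0 0 /\ 0 < p 0 1) T1 T2
  (fun t => vec2 (g1 t).1 (g1 t).2) (fun t => vec2 (g2 t).2 (g2 t).1) Q_rot.
- by move=> p [p0 p1]; rewrite /quarter_turn !(vec2_0, vec2_1);
    split=> -[] /= q0 q1; lia.
- by move=> s t /vec2_inj[E1 E2]; apply: i1; apply: injective_projections.
- by move=> s t /vec2_inj[E1 E2]; apply: i2; apply: injective_projections.
- move=> s t /vec2_inj[E1 E2].
  have [_ [l [m [[l0 m0 _] [F1 F2]]]]] := H1 s.
  have [_ [l' [m' [[l0' m0' _] [F1' F2']]]]] := H2 t.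
  rewrite E1 F2' in F1; rewrite E2 F1' in F2.
  have a1 := mulr_gt0 l0 al0; have a2 := mulr_gt0 l0' al0.
  have h1 : (m' - m) * w1 = l * al by lra.
  have h2 : (m - m') * w2 = l' * al by lra.
  have [mm|mm] := leP m m'.
    have : (m - m') * w2 <= 0 by apply: mulr_le0_ge0 => //; rewrite subr_le0.
    lra.
  have : (m' - m) * w1 <= 0 by apply: mulr_le0_ge0 => //; rewrite subr_le0 ltW.
  lra.
- move=> t; have [j0 [l [m [[l0 m0 lm] [F1 F2]]]]] := H1 t.
  rewrite vec2_0 vec2_1; split.
    split=> //; rewrite -(ltr0z R) -(pmulr_rgt0 _ e0) F1.
    by rewrite ltr_pwDl ?mulr_gt0// mulr_ge0// ltW.
  rewrite lattice_point_vec2 F1 F2.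
  rewrite (_ : vec2 _ _ = l *: vec2 al 0 + m *: vec2 w1 w2);
    first by apply: convex_pair => //; exact: ltW.
  by apply/rowP => k; rewrite !mxE; case: ifP => _ //; rewrite mulr0 add0r.
- move=> t; have [j0 [l [m [[l0 m0 lm] [F1 F2]]]]] := H2 t.
  rewrite vec2_0 vec2_1; split.
    split=> //; rewrite -(ltr0z R) -(pmulr_rgt0 _ e0) F1.
    by rewrite ltr_pwDl ?mulr_gt0// mulr_ge0// ltW.
  rewrite lattice_point_vec2 F1 F2.
  rewrite (_ : vec2 _ _ = l *: vec2 0 al + m *: vec2 w1 w2);
    first by apply: convex_pair => //; exact: ltW.
  by apply/rowP => k; rewrite !mxE; case: ifP => _ //; rewrite mulr0 add0r.
exists T, f; split=> //; rewrite fc natrM natrD -mulrA mulrDl.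
lra.
Qed.

(** The triangles are [0, (s, s), u] and [0, (s, - s), u], in the open cone
    between the two diagonals, and their quarter turns. The lattice bases are
    [(1, 1), (1, 0)] and [(1, - 1), (1, 0)]. *)
Lemma fan_diagonal (s u1 u2 : R) : 0 < s -> `|u2| <= u1 ->
  Q (vec2 s s) -> Q (vec2 u1 u2) -> inner_volume_ge Q (4 * s * u1).
Proof.
move=> s0; rewrite ler_norml => /andP[ul ur] Qs Qu.
have Qs' : Q (vec2 s (- s)).
  by have := Q_rot (Q_rot (Q_rot Qs));
    rewrite /quarter_turn !(vec2_0, vec2_1) opprK.
have h1_ge0 : 0 <= u1 - u2 by lra.
have h2_ge0 : 0 <= u1 + u2 by lra.
exists (4 * ((s + (u1 - u2)) + (s + (u1 + u2)))) => eps e0.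
have [T1 [g1 [i1 H1 c1]]] := triangle_points u2 s0 h1_ge0 e0.
have [T2 [g2 [i2 H2 c2]]] := triangle_points (- u2) s0 h2_ge0 e0.
have [||||||T [f [finj fQ fc]]] :=
  @quarter_turn_fan R Q eps (fun p => - p 0 0 < p 0 1 < p 0 0) T1 T2
  (fun t => vec2 ((g1 t).1 + (g1 t).2) (g1 t).1) (fun t =>
    vec2 ((g2 t).1 + (g2 t).2) (- (g2 t).1)) Q_rot.
- by move=> p /andP[p0 p1]; rewrite /quarter_turn !(vec2_0, vec2_1);
    split=> /andP[] /= q0 q1; lia.
- move=> x y /vec2_inj[E1 E2]; apply: i1; apply: injective_projections => //.
  by move: E1; rewrite E2 => /addrI.
- move=> x y /vec2_inj[E1 /oppr_inj E2]; apply: i2;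
    apply: injective_projections => //.
  by move: E1; rewrite E2 => /addrI.
- move=> x y /vec2_inj[E1 E2].
  have [_ [l [m [[l0 m0 _] [F1 F2]]]]] := H1 x.
  have [_ [l' [m' [[l0' m0' _] [F1' F2']]]]] := H2 y.
  have G1 : eps * (g1 x).1%:~R + eps * (g1 x).2%:~R = eps * (g2 y).1%:~R + eps *
    (g2 y).2%:~R :> R.
    by rewrite -!mulrDr -!intrD E1.
  have G2 : eps * (g1 x).1%:~R = - (eps * (g2 y).1%:~R) :> R.
    by rewrite E2 mulrNz mulrN.
  rewrite F1 F2 F1' F2' in G1; rewrite F1 F1' in G2.
  have a1 := mulr_gt0 l0 s0; have a2 := mulr_gt0 l0' s0.
  have h1 : (m' - m) * (u1 + u2) = 2 * (l * s) by lra.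
  have h2 : (m - m') * (u1 - u2) = 2 * (l' * s) by lra.
  have [mm|mm] := leP m m'.
    have : (m - m') * (u1 - u2) <= 0 by apply: mulr_le0_ge0 => //;
      rewrite subr_le0.
    lra.
  have : (m' - m) * (u1 + u2) <= 0 by apply: mulr_le0_ge0 => //;
    rewrite subr_le0 ltW.
  lra.
- move=> t; have [j0 [l [m [[l0 m0 lm] [F1 F2]]]]] := H1 t.
  rewrite vec2_0 vec2_1; split.
    apply/andP; split; last by rewrite ltrDl.
    rewrite -subr_gt0 opprK -(ltr0z R) -(pmulr_rgt0 _ e0) !intrD !mulrDr F1 F2.
    have := mulr_gt0 l0 s0; have := mulr_ge0 (ltW m0) h2_ge0; lra.
  rewrite lattice_point_vec2 intrD mulrDr F1 F2.
  rewrite (_ : vec2 _ _ = l *: vec2 s s + m *: vec2 u1 u2);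
    first by apply: convex_pair => //; exact: ltW.
  by apply/rowP => k; rewrite !mxE; case: ifP => _ //; ring.
- move=> t; have [j0 [l [m [[l0 m0 lm] [F1 F2]]]]] := H2 t.
  rewrite vec2_0 vec2_1; split.
    apply/andP; split; first by rewrite ltrN2 ltrDl.
    rewrite -subr_gt0 opprK -(ltr0z R) -(pmulr_rgt0 _ e0) !intrD !mulrDr F1 F2.
    have := mulr_gt0 l0 s0; have := mulr_ge0 (ltW m0) h1_ge0; lra.
  rewrite lattice_point_vec2 mulrNz intrD mulrN mulrDr F1 F2.
  rewrite (_ : vec2 _ _ = l *: vec2 s (- s) + m *: vec2 u1 u2);
    first by apply: convex_pair => //; exact: ltW.
  by apply/rowP => k; rewrite !mxE; case: ifP => _ //; ring.
exists T, f; split=> //; rewrite fc natrM natrD -mulrA mulrDl.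
lra.
Qed.

End Fans.

(** * The volume product and the inequality *)

Section PolarBody.
Context {R : realType} {n : nat}.
Variable K : set 'rV[R]_n.
Hypothesis K_convex : convex K.
Hypotheses (K_sym : forall x, K x -> K (- x)) (K_int : K° !=set0).

Lemma convex_sym0 : K 0.
Proof.
have [z /interior_subset Kz] := K_int.
have := @convex_seg _ _ K z (- z) 2^-1 K_convex Kz (K_sym Kz).
rewrite invr_ge0 ler0n invf_le1 ?ler1n// => /(_ isT).
by rewrite scalerN -scalerBl (_ : 2^-1 - (1 - 2^-1) = 0) ?scale0r//; lra.
Qed.

Lemma polar_body_convex : convex (polar_body K).
Proof.
move=> u v l /set_mem Ku /set_mem Kv; apply/mem_set => x Kx.
rewrite /convex.conv /= dotvDr !dotvZr.
have l0 : 0 <= l%:num by [].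
have l1 : 0 <= 1 - l%:num by rewrite subr_ge0.
have := ler_wpM2l l0 (Ku x Kx); have := ler_wpM2l l1 (Kv x Kx).
rewrite /unstable.onem /=; lra.
Qed.

Lemma polar_body0 : polar_body K 0.
Proof. by move=> x _; rewrite dotvC -(scale0r 0) dotvZl mul0r. Qed.

(** Symmetry and convexity put a cross-polytope inside [K], which bounds the
    coordinates on the polar body. *)
Lemma polar_body_compact : compact (polar_body K).
Proof.
apply: bounded_closed_compact.
  have [z Kz] := K_int; have /nbhs_ballP[e /= e0 He] := Kz.
  have Kz' : K z by exact: interior_subset.
  have Kd (i : 'I_n) : K ((e / 4) *: delta_mx 0 i).
    have Kv : K (z + (e / 2) *: delta_mx 0 i).
      apply: He; split => //= i' j; rewrite !mxE /ball /= opprD addNKr normrN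
        normrM.
      rewrite gtr0_norm ?divr_gt0// ger0_norm ?ler0n//.
      have e2 : e / 2 < e by lra.
      by case: (_ && _); rewrite ?mulr1 ?mulr0.
    have := @convex_seg _ _ K (z + (e / 2) *: delta_mx 0 i) (- z) 2^-1 K_convex
      Kv (K_sym Kz').
    rewrite invr_ge0 ler0n invf_le1 ?ler1n// => /(_ isT).
    congr K; apply/rowP => j; rewrite !mxE; lra.
  exists (4 / e); split; first exact: num_real.
  move=> M eM u Ku; apply: le_trans (ltW eM).
  rewrite /Num.Def.normr /= mx_normrE; apply: bigmax_le;
    first by rewrite divr_ge0// ltW.
  move=> [i' i] _ /=; rewrite ord1.
  have := Ku _ (Kd i); have := Ku _ (K_sym (Kd i)); rewrite dotvNl dotvZl.
  have -> : dotv (delta_mx 0 i) u = u 0 i.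
    by rewrite /dotv -rowE mxE mxE.
  move=> h1 h2; rewrite ler_norml; apply/andP; split.
    by rewrite lerNl ler_pdivlMr//; lra.
  by rewrite ler_pdivlMr//; lra.
have -> : polar_body K = \bigcap_(x in K) [set u | dotv u x <= 1].
  by apply/seteqP; split=> u Ku x Kx; have := Ku x Kx; rewrite /= dotvC.
apply: closed_bigI => x Kx.
rewrite (_ : [set u | _] = (fun u => dotv u x) @^-1` [set r | r <= 1])//.
apply: closed_comp; last exact: closed_le.
by move=> u _; exact: continuous_dotvl.
Qed.

End PolarBody.

Definition dilate {R : realType} {n : nat} (t : R) (Q : set 'rV[R]_n) : set
  'rV[R]_n :=
  [set y | Q (t^-1 *: y)].

Lemma dilate_convex (R : realType) n (t : R) (Q : set 'rV[R]_n) : convex Q ->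
  convex (dilate t Q).
Proof.
move=> cQ x y l /set_mem Qx /set_mem Qy; apply/mem_set.
have := set_mem (cQ _ _ l (mem_set Qx) (mem_set Qy)); rewrite /dilate /=.
by rewrite /convex.conv /= scalerDr !scalerA ![t^-1 * _]mulrC.
Qed.

Section VolumeProduct.
Context {R : realType}.

Lemma volume_product_ge3 n (K : set 'rV[R]_n) (t : R) : (2 < n)%N ->
  compact K -> convex K -> so_invariant K -> (forall x, K x -> K (- x)) ->
    K° !=set0 ->
  0 < t -> exists V W : R, [/\ 0 <= V /\ 0 <= W, inner_volume_ge K V,
    inner_volume_ge (dilate t (polar_body K)) W & V * W = (4 * t) ^+ n /
      n`!%:R].
Proof.
move=> n2 cK vK KI Ks Ki t0.
have n0 : (0 < n)%N by exact: ltn_trans n2.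
have [s [s0 Hs Hps]] := exists_polar_corners n2 cK vK KI Ks Ki.
pose r (k : 'I_n) := t / (k.+1%:R * s k).
have r0 k : 0 < r k by rewrite divr_gt0// mulr_gt0.
exists (2 ^+ n * \prod_k s k), (2 ^+ n * \prod_k r k); split.
- by split; rewrite mulr_ge0 ?exprn_ge0//; apply: prodr_ge0 => k _; exact: ltW.
- by apply: inner_volume_ge_corners => //; exact: convex_sym0.
- apply: inner_volume_ge_corners => //.
  + exact/dilate_convex/polar_body_convex.
  + by rewrite /dilate /= scaler0; exact: polar_body0.
  + move=> k sg e; rewrite /dilate /= scalerA /r mulrA mulVf ?gt_eqF// mul1r.
    exact: Hps.
rewrite mulrACA -big_split /=.
rewrite (eq_bigr (fun k : 'I_n => t * k.+1%:R^-1)); last first.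
  move=> k _; rewrite /r; have k0 : k.+1%:R != 0 :> R by rewrite pnatr_eq0.
  have := s0 k; move: (k.+1%:R) (s k) k0 => a b a0 b0.
  by field; rewrite a0 gt_eqF.
rewrite big_split /= prodr_const card_ord prodfV -natr_prod -exprMn.
have -> : (\prod_(k < n) k.+1)%N = n`!.
  by rewrite fact_prod big_add1 big_mkord.
by rewrite mulrA -exprMn; congr (_ ^+ _ / _); lra.
Qed.

(** The dual pairs are [x] with [(1, 1) / rho] and [(f, 0)] with [u], where [f =
    1 / u 0 0]. That [(f, 0)] is in [K] is the bipolar theorem: otherwise a
    separating functional would yield a point of the polar body with larger
    first coordinate than [u]. *)
Lemma volume_product_dim2 (K : set 'rV[R]_2) (t : R) :
  compact K -> convex K -> so_invariant K -> (forall x, K x -> K (- x)) ->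
    K° !=set0 ->
  0 < t -> exists V W : R, [/\ 0 <= V /\ 0 <= W, inner_volume_ge K V,
    inner_volume_ge (dilate t (polar_body K)) W & V * W = (4 * t) ^+ 2 /
      2`!%:R].
Proof.
move=> cK vK KI Ks Ki t0.
have K0 := convex_sym0 vK Ks Ki.
have Krot x : K x -> K (quarter_turn x) by exact: so_invariant_quarter_turn.
have PI : so_invariant (polar_body K) by exact: so_invariant_polar.
have Prot x : polar_body K x -> polar_body K (quarter_turn x) by exact:
  so_invariant_quarter_turn.
have dv (a b : R) x : dotv x (vec2 a b) = x 0 0 * a + x 0 1 * b.
  rewrite dotvE !big_ord_recl big_ord0 addr0 !mxE /=.
  by rewrite (_ : lift _ _ = 1)//; apply/val_inj.
have vec0 (a b : R) : a != 0 -> vec2 a b != 0.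
  by move=> a0; apply/eqP => /rowP/(_ 0); rewrite vec2_0 mxE => /eqP;
    rewrite (negbTE a0).
have one0 : (1 : R) != 0 by exact: oner_neq0.
have [y Ky y0] := body_dotv_gt0 Ks Ki (vec0 1 1 one0).
have [|x Kx xmax] := EVT_max_rV (f :=
  fun y => dotv y (vec2 1 1)) (ex_intro _ y Ky) cK.
  by apply: continuous_subspaceT => z; exact: continuous_dotvl.
have {}Kx := set_mem Kx.
have {}xmax z : K z -> dotv z (vec2 1 1) <= dotv x (vec2 1 1) by move=> Kz;
  exact: (xmax z (mem_set Kz)).
pose rho := dotv x (vec2 1 1).
have rho0 : 0 < rho by apply: lt_le_trans y0 (xmax _ Ky).
have rhoE : rho = x 0 0 + x 0 1 by rewrite /rho dv !mulr1.
have x1 : 0 <= x 0 1.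
  have := xmax _ (Krot _ Kx); rewrite !dv /quarter_turn vec2_0 vec2_1; lra.
have x0 : 0 <= x 0 0.
  have := xmax _ (Krot _ (Krot _ (Krot _ Kx)));
    rewrite !dv /quarter_turn !(vec2_0, vec2_1); lra.
have Pd : polar_body K (vec2 rho^-1 rho^-1).
  move=> z Kz; rewrite dv -mulrDl ler_pdivrMr// mul1r.
  by have := xmax _ Kz; rewrite -/rho dv !mulr1.
have [u Pu umax] : exists2 u, polar_body K u & forall v, polar_body K v ->
  v 0 0 <= u 0 0.
  have [|u Pu umax] := EVT_max_rV (f := fun y : 'rV[R]_2 => y 0 0)
    (ex_intro _ _ Pd) (polar_body_compact vK Ks Ki).
    by apply: continuous_subspaceT => z; exact: coord_continuous.
  exists u; first exact: (set_mem Pu).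
  by move=> v Pv; exact: (umax v (mem_set Pv)).
have u0 : 0 < u 0 0.
  by apply: lt_le_trans (umax _ Pd); rewrite vec2_0 invr_gt0.
have uN : `|u 0 1| <= u 0 0.
  have := umax _ (Prot _ Pu); have := umax _ (Prot _ (Prot _ (Prot _ Pu))).
  by rewrite /quarter_turn !(vec2_0, vec2_1) opprK ler_norml lerNl => -> ->.
have Kf : K (vec2 (u 0 0)^-1 0).
  apply: contrapT => nK.
  have [v [b [Kb bv]]] := separation cK vK (ex_intro _ 0 K0) nK.
  have b0 : 0 <= b by have := Kb _ K0; rewrite -(scale0r 0) dotvZl mul0r.
  rewrite dotvC dv mulr0 addr0 in bv.
  (* Scaling [v] by a number strictly between the two sides of the separation,
     since [b] may vanish. *)
  pose b' := (b + v 0 0 / u 0 0) / 2.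
  have b'0 : 0 < b' by rewrite /b'; lra.
  have : polar_body K (b'^-1 *: v).
    move=> z Kz; rewrite dotvZr mulrC ler_pdivrMr// mul1r.
    by apply: le_trans (Kb z Kz) _; rewrite /b'; lra.
  move=> /umax; rewrite mxE mulrC ler_pdivrMr// mulrC -ler_pdivrMr//.
  by apply/negP; rewrite -ltNge /b'; lra.
exists (2 * (u 0 0)^-1 * (x 0 0 + x 0 1)), (4 * (t / rho) * (t * u 0 0)); split.
- have x01 : 0 <= x 0 0 + x 0 1 by rewrite addr_ge0.
  by split; rewrite !mulr_ge0// ?invr_ge0// ltW.
- apply: fan_axis => //; first by rewrite invr_gt0.
  by rewrite -vec2_eta.
- have tN0 : t != 0 by rewrite gt_eqF.
  apply: (@fan_diagonal _ _ _ _ _ _ _ (t * u 0 1)).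
  + exact/dilate_convex/polar_body_convex.
  + by rewrite /dilate /= scaler0; exact: polar_body0.
  + move=> y'; rewrite /dilate /= => /Prot; congr (polar_body K _).
    by apply/rowP => k; rewrite !mxE; case: ifP => _; rewrite ?mulrN.
  + by rewrite divr_gt0.
  + by rewrite normrM gtr0_norm// ler_pM2l.
  + rewrite /dilate /= (_ : _ *: _ = vec2 rho^-1 rho^-1)//.
    by apply/rowP => k; rewrite !mxE; case: ifP => _; rewrite mulKf.
  rewrite /dilate /= (_ : _ *: _ = u)//.
  by rewrite [RHS]vec2_eta; apply/rowP => k; rewrite !mxE; case: ifP => _;
    rewrite mulKf.
rewrite -rhoE (_ : 2`! = 2)//; field; rewrite !gt_eqF//.
Qed.

(** The symmetric Mahler inequality for [K], with the polar body scaled by [t]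
    and volumes replaced by lattice point densities. *)
Lemma volume_product n (K : set 'rV[R]_n) (t : R) : (0 < n)%N -> ~~ odd n ->
  compact K -> convex K -> so_invariant K -> K° !=set0 ->
  0 < t -> exists V W : R, [/\ 0 <= V /\ 0 <= W, inner_volume_ge K V,
    inner_volume_ge (dilate t (polar_body K)) W & V * W = (4 * t) ^+ n /
      n`!%:R].
Proof.
case: n K => [//|[//|[|n]]] K _ nev cK vK KI Ki t0.
  by apply: volume_product_dim2 => // x; exact: so_invariant_opp.
by apply: volume_product_ge3 => // x; exact: so_invariant_opp.
Qed.

End VolumeProduct.

Theorem corollary1p6 (R : realType) (n : nat) (n_gt0 : (0 < n)%N)
    (n_even : ~~ odd n) (K L : set 'rV[R]_n)
    (K_body : convex_body K)
    (K_inv : forall g : 'M[R]_n, SO_cross_polytope g -> mx_image g K = K)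
    (L_body : convex_body L) (L_sym : centrally_symmetric L)
    (c : symplectic_manifold R n -> \bar R)
    (c_capacity : symplectic_capacity n_gt0 c) :
  (capacity_body c (lagrangian_product K L) ^+ n <=
   n`!%:R%:E * volume (lagrangian_product K L))%E.
Proof.
have [cK vK Ki] := K_body; have [cL vL Li] := L_body.
have KI := so_invariant_of_image K_inv.
have Ks x : K x -> K (- x) by exact: so_invariant_opp.
have Ls x : L x -> L (- x) by move=> Lx; rewrite -L_sym; exists x.
have L0 : L !=set0 by have [z /interior_subset Lz] := Li; exists z.
have cfin := capacity_lagrangian_fin_num c_capacity cK cL.
have c0 : (0 <= capacity_body c (lagrangian_product K L))%E by exact:
  (capacity_ge0 c_capacity).
have := @dilate_polar_sub _ _ n_gt0 c c_capacity K L Ks cL vL Ls L0.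
rewrite -(fineK cfin) in c0 *; move: (fine _) c0 => r; rewrite lee_fin => r0 HL.
have f0 : 0 < n`!%:R :> R by rewrite ltr0n fact_gt0.
have vol0 : (0 <= volume (lagrangian_product K L))%E.
  apply: le_ereal_inf_tmp => _ [F _ <-]; apply: nneseries_ge0 => k _ _.
  by rewrite lee_fin; apply: prodr_ge0 => i _; rewrite le_max lexx.
rewrite -EFin_expe.
have [r_eq0|r_neq0] := eqVneq r 0.
  by rewrite r_eq0 expr0n gtn_eqF//= mule_ge0// lee_fin ltW.
have r4 : 0 < r / 4 by rewrite divr_gt0// lt_neqAle eq_sym r_neq0.
have [V [W [[V0 W0] HV HW VW]]] := volume_product n_gt0 n_even cK vK KI Ki r4.
have HW' : inner_volume_ge L W.
  have [C HC] := HW; exists C => eps e0; have [T [f [fi fQ fc]]] := HC eps e0.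
  exists T, f; split=> // t; have := HL r _ r0 (lexx _) (fQ t).
  by rewrite scalerA divff ?gt_eqF// scale1r.
have := volume_lagrangian_product_ge cK cL V0 W0 HV HW'.
rewrite VW (_ : 4 * (r / 4) = r) => [H|]; last by field.
have -> : (r ^+ n)%:E = (n`!%:R%:E * (r ^+ n / n`!%:R)%:E)%E.
  by rewrite -EFinM mulrC divfK// gt_eqF.
by apply: lee_wpmul2l => //; rewrite lee_fin ltW.
Qed.
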